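(* Let $\varphi\in L^1_{\mathrm{loc}}(\mathbb{R}_+)$. The following are equivalent: (i) $Q_\varphi$ is compact on $L^2(\mathbb{R}_+)$; (ii) $Q^+_\varphi$ is compact on $L^2(\mathbb{R}_+)$; (iii) $\varphi\in X^0_\infty$.
   Context: $\mathbb{R}_+=(0,\infty)$, and ''loc'' refers to compact subsets of $(0,\infty)$. For a locally integrable complex-valued function $\varphi$ on $\mathbb{R}_+$, the operators $Q_\varphi$ and $Q_\varphi^+$ are defined on bounded functions $f$ with compact support in $\mathbb{R}_+$ by $$(Q_\varphi f)(x)=\int_0^\infty\varphi(\max\{x,y\})f(y)\,dy,\qquad (Q^+_\varphi f)(x)=\varphi(x)\int_0^x f(y)\,dy .$$ Such an operator is called compact on $L^2(\mathbb{R}_+)$ if it extends to a bounded operator on $L^2(\mathbb{R}_+)$ and this extension is compact. $X_\infty$ is the space of all measurable functions $\varphi$ on $\mathbb{R}_+$ such that $\sup_{n\in\mathbb{Z}}2^n\int_{2^n}^{2^{n+1}}|\varphi(x)|^2\,dx<\infty$. $X^0_\infty$ is the subspace of those $\varphi\in X_\infty$ such that $\lim_{n\to\pm\infty}2^n\int_{2^n}^{2^{n+1}}|\varphi(x)|^2\,dx=0$ (equivalently, $\lim_{x\to0}x\int_x^\infty|\varphi(y)|^2dy=\lim_{x\to\infty}x\int_x^\infty|\varphi(y)|^2dy=0$). *)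

(* Defs.v *)
From mathcomp Require Import all_boot all_order all_algebra.
From mathcomp Require Import all_classical all_reals all_analysis.
From mathcomp Require Import complex.

Set Implicit Arguments.
Unset Strict Implicit.
Unset Printing Implicit Defensive.

Import Order.TTheory GRing.Theory Num.Theory numFieldNormedType.Exports.

Local Open Scope classical_set_scope.
Local Open Scope ring_scope.
Local Open Scope complex_scope.

(* Complex-valued functions on R_+ = (0, oo) are represented by total functions
   R -> R[i] whose values outside Rplus are irrelevant.  Measurability is Borel
   measurability of the real and imaginary parts. *)
Section ComplexFunctions.
Context {R : realType}.
Implicit Types (f g : R -> R[i]) (D : set R).

Definition Rplus : set R := `]0, +oo[.

Definition cmod (z : R[i]) : R := ComplexField.Normc.normc z.

Definition cmeasurable D f : Prop :=
  measurable_fun D (fun x => complex.Re (f x)) /\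
  measurable_fun D (fun x => complex.Im (f x)).

Definition cintegral D f : R[i] :=
  (\int[lebesgue_measure]_(x in D) complex.Re (f x))%R +i*
  (\int[lebesgue_measure]_(x in D) complex.Im (f x))%R.

Definition ae_eq_Rplus f g : Prop :=
  f = g %[ae lebesgue_measure in Rplus].

Definition L1loc f : Prop :=
  cmeasurable Rplus f /\ locally_integrable Rplus (fun x => cmod (f x)).

Definition L2norm f : \bar R :=
  ((\int[lebesgue_measure]_(x in Rplus) ((cmod (f x)) ^+ 2)%:E) `^ (2^-1)%R)%E.

Definition L2 f : Prop := cmeasurable Rplus f /\ (L2norm f < +oo)%E.

Definition bounded_csupp f : Prop :=
  [/\ cmeasurable Rplus f,
      exists M : R, forall x, Rplus x -> cmod (f x) <= M &
      exists K : set R, [/\ compact K, K `<=` Rplus &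
        forall x, Rplus x -> ~ K x -> f x = 0]].

End ComplexFunctions.

Section Operators.
Context {R : realType}.
Implicit Types (Q T : (R -> R[i]) -> (R -> R[i])) (phi : R -> R[i]).

(* An operator on the space L^2(R_+) of classes modulo a.e. equality is
   represented by a map T acting on representatives.  Linearity up to a.e.
   equality and boundedness force T to respect a.e. equality. *)
Definition bounded_operator T : Prop :=
  [/\ forall f, L2 f -> L2 (T f),
      forall (a : R[i]) f g, L2 f -> L2 g ->
        ae_eq_Rplus (T (fun x => a * f x + g x))
                    (fun x => a * T f x + T g x) &
      exists C : R, forall f, L2 f -> (L2norm (T f) <= C%:E * L2norm f)%E].

Definition compact_operator T : Prop :=
  bounded_operator T /\
  forall f : nat -> R -> R[i],
    (forall n, L2 (f n)) ->
    (exists M : R, forall n, (L2norm (f n) <= M%:E)%E) ->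
    exists (k : nat -> nat) (g : R -> R[i]),
      [/\ {homo k : m n / (m < n)%N}, L2 g &
          (fun n => L2norm (fun x => T (f (k n)) x - g x)) @ \oo --> 0%E].

Definition compact_on_L2 Q : Prop :=
  exists T, compact_operator T /\
    forall f, bounded_csupp f -> ae_eq_Rplus (T f) (Q f).

Definition Qop phi (f : R -> R[i]) (x : R) : R[i] :=
  cintegral Rplus (fun y => phi (Num.max x y) * f y).

Definition Qplus phi (f : R -> R[i]) (x : R) : R[i] :=
  phi x * cintegral `]0, x[ f.

(* ^ is integer exponentiation here: n ranges over int *)
Definition dyadic phi (n : int) : \bar R :=
  ((2 ^ n)%:E * \int[lebesgue_measure]_(x in `[2%R ^ n, 2%R ^ (n + 1)])
                  ((cmod (phi x)) ^+ 2)%:E)%E.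

Definition Xinfty phi : Prop :=
  cmeasurable Rplus phi /\ (ereal_sup (range (dyadic phi)) < +oo)%E.

Definition X0infty phi : Prop :=
  [/\ Xinfty phi,
      (fun n : nat => dyadic phi n%:Z) @ \oo --> 0%E &
      (fun n : nat => dyadic phi (- n%:Z)) @ \oo --> 0%E].

End Operators.

(* Main.v *)
Require Import Defs.
From mathcomp Require Import all_boot all_order all_algebra.
From mathcomp Require Import all_classical all_reals all_analysis.
From mathcomp Require Import measurable_realfun complex ring lra.

Set Implicit Arguments.
Unset Strict Implicit.
Unset Printing Implicit Defensive.

Import Order.TTheory GRing.Theory Num.Theory numFieldNormedType.Exports.

Local Open Scope classical_set_scope.
Local Open Scope ring_scope.

(** With [F x] the integral of [f] over ]0, x[ and [G x] that of [phi f] over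
    [x, oo[, the two operators are [Q+ f = phi F] and [Q f = phi F + G].
    Everything is governed by the dyadic quantities
    [d n = 2^n * int_(2^n)^(2^(n+1)) |phi|^2].

    From decay of [d] to compactness.  Cauchy-Schwarz with the weights [y^(-1/2)]
    and [y^(1/2)] gives [|F x|^2 <= 8 x^(1/2) int_0^x y^(1/2) |f y|^2 dy], so by
    Tonelli [||phi F||] is controlled by the weighted tails
    [int_y^oo x^(1/2) |phi x|^2 dx].  Cut along powers of 2, such a tail is
    dominated by a geometric series: it is at most [12 D / y^(1/2)] when all
    [d n <= D] ([sqrt_tail_le]).  Exchanging the two weights bounds [||G||] by the
    same tails ([hardy_lower], [hardy_upper]).  These bounds also show that when
    [d] tends to 0 at both ends, the norms of [phi F] and [G] outside a compact
    interval [a, b] are small uniformly on bounded sets of [f].  Inside [a, b]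
    compactness is of Arzela-Ascoli type: on a bounded sequence the functions
    [F] (resp. [G]) are locally bounded and equicontinuous, hence a subsequence
    converges at every point, and dominated convergence turns this into
    convergence of the norms ([energy_compact_criterion]).

    From compactness to decay of [d].  The normalised indicator [b] of ]a/2, a]
    is sent by either operator to [phi x * a^(1/2) / 2] at every [x > a]; hence
    [d n <= 4 ||T b||^2] for [a = 2^n], and boundedness of [T] bounds [d].  These
    indicators have disjoint supports, so a compact [T] sends them to 0
    ([compact_disjoint_cvg0]): if [T f_n] tends to [g] along a subsequence, a sum
    of [N] late terms has norm at most [N^(1/2)] while its image is close to
    [N g], so that [N ||g|| <= C N^(1/2)] for every [N] and [g = 0].

    Squared norms are used instead of norms: they are plain integrals, and
    [|z + w|^2 <= 2 |z|^2 + 2 |w|^2] replaces the triangle inequality. *)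

(** * Squared moduli and measurability of complex functions *)

Section SquaredModulus.
Context {R : realType}.
Implicit Types (z w : R[i]).

Definition sqmod z : R := complex.Re z ^+ 2 + complex.Im z ^+ 2.

Lemma cmod_sq z : cmod z ^+ 2 = sqmod z.
Proof. by case: z => a b; rewrite /cmod /= sqr_sqrtr// addr_ge0// sqr_ge0. Qed.

Lemma sqmod_ge0 z : 0 <= sqmod z.
Proof. by rewrite addr_ge0// sqr_ge0. Qed.

Lemma sqmod0 : sqmod 0 = 0.
Proof. by rewrite /sqmod /= expr0n /= addr0. Qed.

Lemma sqmodM z w : sqmod (z * w) = sqmod z * sqmod w.
Proof. by case: z => a b; case: w => c d; rewrite /sqmod /=; ring. Qed.

Lemma sqmodN z : sqmod (- z) = sqmod z.
Proof. by case: z => a b; rewrite /sqmod /= !sqrrN. Qed.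

Lemma sqmodD_le z w : sqmod (z + w) <= 2 * sqmod z + 2 * sqmod w.
Proof.
case: z => a b; case: w => c d; rewrite /sqmod /= -subr_ge0.
have -> : 2 * (a ^+ 2 + b ^+ 2) + 2 * (c ^+ 2 + d ^+ 2) -
  ((a + c) ^+ 2 + (b + d) ^+ 2) = (a - c) ^+ 2 + (b - d) ^+ 2 by ring.
by rewrite addr_ge0// sqr_ge0.
Qed.

Lemma sqmodB_le z w : sqmod (z - w) <= 2 * sqmod z + 2 * sqmod w.
Proof. by rewrite -(sqmodN w); exact: sqmodD_le. Qed.

Lemma sqr_Re_le z : complex.Re z ^+ 2 <= sqmod z.
Proof. by rewrite lerDl sqr_ge0. Qed.

Lemma sqr_Im_le z : complex.Im z ^+ 2 <= sqmod z.
Proof. by rewrite lerDr sqr_ge0. Qed.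

Lemma ReCD z w : complex.Re (z + w) = complex.Re z + complex.Re w.
Proof. by case: z; case: w. Qed.
Lemma ImCD z w : complex.Im (z + w) = complex.Im z + complex.Im w.
Proof. by case: z; case: w. Qed.
Lemma ReCN z : complex.Re (- z) = - complex.Re z.
Proof. by case: z. Qed.
Lemma ImCN z : complex.Im (- z) = - complex.Im z.
Proof. by case: z. Qed.
Lemma ReCM z w : complex.Re (z * w) =
  complex.Re z * complex.Re w - complex.Im z * complex.Im w.
Proof. by case: z; case: w. Qed.
Lemma ImCM z w : complex.Im (z * w) =
  complex.Re z * complex.Im w + complex.Im z * complex.Re w.
Proof. by case: z; case: w. Qed.

End SquaredModulus.

Section Measurability.
Context {R : realType}.
Implicit Types (D : set R) (f g : R -> R[i]).

Lemma cmeasurableD D f g : cmeasurable D f -> cmeasurable D g ->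
  cmeasurable D (fun x => f x + g x).
Proof.
move=> [f1 f2] [g1 g2]; split.
- by under eq_fun do rewrite ReCD; exact: measurable_funD.
- by under eq_fun do rewrite ImCD; exact: measurable_funD.
Qed.

Lemma cmeasurableN D f : cmeasurable D f -> cmeasurable D (fun x => - f x).
Proof.
move=> [f1 f2]; split.
- by under eq_fun do rewrite ReCN; exact: measurable_funN.
- by under eq_fun do rewrite ImCN; exact: measurable_funN.
Qed.

Lemma cmeasurableM D f g : cmeasurable D f -> cmeasurable D g ->
  cmeasurable D (fun x => f x * g x).
Proof.
move=> [f1 f2] [g1 g2]; split.
- by under eq_fun do rewrite ReCM; apply: measurable_funB; exact: measurable_funM.
- by under eq_fun do rewrite ImCM; apply: measurable_funD; exact: measurable_funM.
Qed.

Lemma cmeasurable_cst D (a : R[i]) : cmeasurable D (fun=> a).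
Proof. by split; exact: measurable_cst. Qed.

Lemma cmeasurableS D E f : measurable E -> D `<=` E ->
  cmeasurable E f -> cmeasurable D f.
Proof. by move=> mE DE [f1 f2]; split; exact: measurable_funS f1 || exact: measurable_funS f2. Qed.

Lemma measurable_sqmod D f : cmeasurable D f ->
  measurable_fun D (fun x => sqmod (f x)).
Proof. by move=> [f1 f2]; apply: measurable_funD; exact: measurable_funX. Qed.

Lemma measurable_EFin_sqmod D f : cmeasurable D f ->
  measurable_fun D (fun x => (sqmod (f x))%:E).
Proof. by move=> mf; apply/measurable_EFinP; exact: measurable_sqmod. Qed.

Lemma measurable_Rplus : measurable (Rplus : set R).
Proof. exact: measurable_itv. Qed.

End Measurability.

(** * Squared norms and compact operators *)

Lemma leq_subsequence (k : nat -> nat) :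
  {homo k : m n / (m < n)%N} -> forall n, (n <= k n)%N.
Proof. by move=> kinc; elim=> // n ih; apply: leq_ltn_trans ih _; exact: kinc. Qed.

Lemma subsequence_cvg_infty (k : nat -> nat) :
  {homo k : m n / (m < n)%N} -> k n @[n --> \oo] --> \oo.
Proof.
move=> kinc; apply/cvgnyPge => A; near=> n.
apply: leq_trans (leq_subsequence kinc n).
by near: n; exact: nbhs_infty_ge.
Unshelve. all: by end_near. Qed.

Section NonnegativeLimits.
Context {R : realType}.
Local Open Scope ereal_scope.

Lemma cvge0P (u : nat -> \bar R) : (forall n, 0 <= u n) ->
  u @ \oo --> 0 <->
  forall e : R, (0 < e)%R -> \forall n \near \oo, u n <= e%:E.
Proof.
move=> u0; split=> [/fine_cvgP[ufin /cvgrPdist_le ue] e e0|ue].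
- near=> n.
  have fn : u n \is a fin_num by near: n.
  rewrite -(fineK fn) lee_fin.
  have : (`|0 - fine (u n)| <= e)%R by near: n; exact: ue.
  by rewrite sub0r normrN ger0_norm// fine_ge0.
- have ufin : \forall n \near \oo, u n \is a fin_num.
    near=> n; rewrite ge0_fin_numE//; apply: (@le_lt_trans _ _ 1%:E); last exact: ltey.
    by near: n; exact: ue.
  apply/fine_cvgP; split => //.
  apply/cvgrPdist_le => e e0; near=> n.
  have fn : u n \is a fin_num by near: n.
  rewrite sub0r normrN ger0_norm ?fine_ge0// -lee_fin fineK//.
  by near: n; exact: ue.
Unshelve. all: by end_near. Qed.

End NonnegativeLimits.

Section Energy.
Context {R : realType}.
Local Notation mu := (@lebesgue_measure R).
Implicit Types (D : set R) (f g : R -> R[i]).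
Local Open Scope ereal_scope.

Definition energy D f : \bar R := \int[mu]_(x in D) (sqmod (f x))%:E.

Lemma energy_ge0 D f : 0 <= energy D f.
Proof. by apply: integral_ge0 => x _; rewrite lee_fin sqmod_ge0. Qed.

Lemma L2norm_energy f : L2norm f = sqrte (energy Rplus f).
Proof.
rewrite -poweR12_sqrt ?energy_ge0//.
by congr (_ `^ _); apply: eq_integral => x _; rewrite cmod_sq.
Qed.

Lemma L2norm_ge0 f : 0 <= L2norm f.
Proof. by rewrite L2norm_energy sqrte_ge0. Qed.

Lemma energyD_le D f g : measurable D -> cmeasurable D f -> cmeasurable D g ->
  energy D (fun x => f x + g x)%R <= 2%:E * energy D f + 2%:E * energy D g.
Proof.
move=> mD mf mg; rewrite -!ge0_integralZl_EFin//; last 4 first.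
- by move=> x _; rewrite lee_fin sqmod_ge0.
- exact: measurable_EFin_sqmod.
- by move=> x _; rewrite lee_fin sqmod_ge0.
- exact: measurable_EFin_sqmod.
rewrite -ge0_integralD//; last 4 first.
- by move=> x _; rewrite -EFinM lee_fin mulr_ge0// sqmod_ge0.
- by apply/measurable_EFinP; apply: measurable_funM => //; exact: measurable_sqmod.
- by move=> x _; rewrite -EFinM lee_fin mulr_ge0// sqmod_ge0.
- by apply/measurable_EFinP; apply: measurable_funM => //; exact: measurable_sqmod.
apply: ge0_le_integral => //.
- by move=> x _; rewrite lee_fin sqmod_ge0.
- by apply: measurable_EFin_sqmod; exact: cmeasurableD.
- apply: emeasurable_funD; apply/measurable_EFinP;
  by apply: measurable_funM => //; exact: measurable_sqmod.
- by move=> x _; rewrite -!EFinM -EFinD lee_fin sqmodD_le.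
Qed.

Lemma energyN D f : energy D (fun x => - f x)%R = energy D f.
Proof. by apply: eq_integral => x _; rewrite sqmodN. Qed.

Lemma energyB_le D f g : measurable D -> cmeasurable D f -> cmeasurable D g ->
  energy D (fun x => f x - g x)%R <= 2%:E * energy D f + 2%:E * energy D g.
Proof.
move=> mD mf mg; rewrite -(energyN D g).
by apply: energyD_le => //; exact: cmeasurableN.
Qed.

Lemma energyZ D f (a : R[i]) : measurable D -> cmeasurable D f ->
  energy D (fun x => a * f x)%R = (sqmod a)%:E * energy D f.
Proof.
move=> mD mf; rewrite -ge0_integralZl_EFin ?sqmod_ge0//.
- by apply: eq_integral => x _; rewrite sqmodM EFinM.
- by move=> x _; rewrite lee_fin sqmod_ge0.
- exact: measurable_EFin_sqmod.
Qed.

Lemma eq_energy D f g : {in D, f =1 g} -> energy D f = energy D g.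
Proof. by move=> fg; apply: eq_integral => x xD; rewrite fg. Qed.

Lemma ae_eq_energy f g : cmeasurable Rplus f -> cmeasurable Rplus g ->
  ae_eq_Rplus f g -> energy Rplus f = energy Rplus g.
Proof.
move=> mf mg fg; apply: ge0_ae_eq_integral.
- exact: measurable_Rplus.
- exact: measurable_EFin_sqmod.
- exact: measurable_EFin_sqmod.
- by move=> x _; rewrite lee_fin sqmod_ge0.
- by move=> x _; rewrite lee_fin sqmod_ge0.
- case: fg => N [mN N0 sub]; exists N; split => //; apply: subset_trans sub.
  by move=> x /= nfg fgx; apply: nfg => Dx; rewrite fgx.
Qed.

Lemma L2P f : L2 f <-> cmeasurable Rplus f /\ energy Rplus f < +oo.
Proof.
rewrite /L2 L2norm_energy -!ge0_fin_numE ?energy_ge0 ?sqrte_ge0//.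
by rewrite sqrte_fin_num ?energy_ge0.
Qed.

Lemma L2norm_leP f (c : R) : (0 <= c)%R ->
  (L2norm f <= c%:E) = (energy Rplus f <= (c ^+ 2)%:E).
Proof.
move=> c0; rewrite L2norm_energy.
have -> : c%:E = sqrte (c ^+ 2)%:E by rewrite /= sqrtr_sqr ger0_norm.
by rewrite lee_sqrt// lee_fin sqr_ge0.
Qed.

Lemma L2norm_le_energy f g (c : R) : (0 <= c)%R ->
  (L2norm f <= c%:E * L2norm g) = (energy Rplus f <= (c ^+ 2)%:E * energy Rplus g).
Proof.
move=> c0; rewrite !L2norm_energy.
have -> : c%:E = sqrte (c ^+ 2)%:E by rewrite /= sqrtr_sqr ger0_norm.
rewrite -sqrteM ?lee_fin ?sqr_ge0// lee_sqrt// mule_ge0 ?energy_ge0//.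
by rewrite lee_fin sqr_ge0.
Qed.

Lemma L2norm_cvg0 (f : nat -> R -> R[i]) :
  (fun n => L2norm (f n)) @ \oo --> 0 <->
  (fun n => energy Rplus (f n)) @ \oo --> 0.
Proof.
split=> h.
- apply/cvge0P => [n|e e0]; first exact: energy_ge0.
  have se0 : (0 < Num.sqrt e)%R by rewrite sqrtr_gt0.
  move/cvge0P : h => /(_ (fun=> L2norm_ge0 _) _ se0); apply: filterS => n.
  by rewrite (L2norm_leP _ (ltW se0)) (sqr_sqrtr (ltW e0)).
- apply/cvge0P => [n|e e0]; first exact: L2norm_ge0.
  have e20 : (0 < e ^+ 2)%R by rewrite exprn_gt0.
  move/cvge0P : h => /(_ (fun=> energy_ge0 _ _) _ e20); apply: filterS => n.
  by rewrite (L2norm_leP _ (ltW e0)).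
Qed.

End Energy.

Section EnergyCompact.
Context {R : realType}.
Implicit Types (T : (R -> R[i]) -> R -> R[i]) (f g : R -> R[i]).
Local Open Scope ereal_scope.

Lemma L2_linear (a : R[i]) f g : L2 f -> L2 g -> L2 (fun x => a * f x + g x)%R.
Proof.
move=> /L2P[mf f2] /L2P[mg g2]; apply/L2P.
have maf : cmeasurable Rplus (fun x => a * f x)%R.
  by apply: cmeasurableM => //; exact: cmeasurable_cst.
split; first exact: cmeasurableD.
apply: le_lt_trans; first by apply: energyD_le => //; exact: measurable_Rplus.
by rewrite energyZ ?lte_add_pinfty ?lte_mul_pinfty// ?lee_fin ?mule_ge0 ?energy_ge0 ?lee_fin
  ?sqmod_ge0//;
  exact: measurable_Rplus.
Qed.

(** Compactness in terms of squared norms, with linearity at every point of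
    the half-line rather than almost everywhere; the integral operators below
    satisfy it in this strict form, which makes sums immediate. *)
Record energy_compact T : Prop := EnergyCompact {
  ec_meas : forall f, L2 f -> cmeasurable Rplus (T f) ;
  ec_linear : forall (a : R[i]) f g, L2 f -> L2 g -> forall x, Rplus x ->
    T (fun x => a * f x + g x)%R x = (a * T f x + T g x)%R ;
  ec_bounded : exists2 C : R, (0 <= C)%R &
    forall f, L2 f -> energy Rplus (T f) <= C%:E * energy Rplus f ;
  ec_seq : forall (f : nat -> R -> R[i]) (M : R),
    (forall n, L2 (f n)) -> (forall n, energy Rplus (f n) <= M%:E) ->
    exists (k : nat -> nat) (g : R -> R[i]),
      [/\ {homo k : m n / (m < n)%N}, L2 g &
        (fun n => energy Rplus (fun x => T (f (k n)) x - g x)%R) @ \oo --> 0] }.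

Lemma energy_compact_compact T : energy_compact T -> compact_operator T.
Proof.
move=> [mT lT [C C0 bT] sT]; split; first split.
- move=> f Lf; apply/L2P; split; first exact: mT.
  apply: (le_lt_trans (bT _ Lf)); case/L2P: Lf => _ f2.
  by rewrite lte_mul_pinfty// ?lee_fin.
- move=> a f g Lf Lg; exists set0; split => //=.
  by rewrite subset0 -subset0 => x /= h; apply: h => Rx; exact: lT.
- exists (Num.sqrt C) => f Lf.
  by rewrite L2norm_le_energy ?sqrtr_ge0// sqr_sqrtr//; exact: bT.
- move=> f Lf [M fM]; have M0 : (0 <= M)%R.
    by rewrite -lee_fin; exact: le_trans (L2norm_ge0 _) (fM 0%N).
  have [|k [g [kinc Lg kg]]] := sT f (M ^+ 2)%R Lf.
    by move=> n; rewrite -L2norm_leP.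
  by exists k, g; split => //; apply/L2norm_cvg0.
Qed.

Lemma energy_compactD T1 T2 : energy_compact T1 -> energy_compact T2 ->
  energy_compact (fun f x => T1 f x + T2 f x)%R.
Proof.
move=> [m1 l1 [C1 C10 b1] s1] [m2 l2 [C2 C20 b2] s2]; split.
- by move=> f Lf; apply: cmeasurableD; [exact: m1|exact: m2].
- by move=> a f g Lf Lg x Rx; rewrite l1// l2//; ring.
- exists (2 * C1 + 2 * C2)%R; first by rewrite addr_ge0// mulr_ge0.
  move=> f Lf; apply: le_trans.
    by apply: energyD_le; [exact: measurable_Rplus|exact: m1|exact: m2].
  have -> : (2 * C1 + 2 * C2)%:E = 2%:E * C1%:E + 2%:E * C2%:E by [].
  rewrite ge0_muleDl ?mule_ge0 ?lee_fin// -!muleA.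
  by apply: leeD; apply: lee_wpmul2l; rewrite ?lee_fin ?b1 ?b2.
- move=> f M Lf fM.
  have [k1 [g1 [k1inc Lg1 kg1]]] := s1 f M Lf fM.
  have [k2 [g2 [k2inc Lg2 kg2]]] := s2 (f \o k1) M (fun=> Lf _) (fun=> fM _).
  exists (k1 \o k2), (fun x => g1 x + g2 x)%R; split.
  + by move=> m n mn /=; apply/k1inc/k2inc.
  + have := L2_linear 1%R Lg1 Lg2; congr L2.
    by apply/funext => x; rewrite mul1r.
  + have k2oo : k2 n @[n --> \oo] --> \oo%classic.
      exact: subsequence_cvg_infty.
    apply/cvge0P => [n|e e0]; first exact: energy_ge0.
    have e40 : (0 < e / 4)%R by rewrite divr_gt0.
    move/cvge0P : kg1 => /(_ (fun=> energy_ge0 _ _) _ e40) /k2oo kg1.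
    move/cvge0P : kg2 => /(_ (fun=> energy_ge0 _ _) _ e40) kg2.
    near=> n.
    have -> : (e = 2 * (e / 4) + 2 * (e / 4))%R by field.
    set h := (fun x => _); have -> : h = fun x =>
      ((T1 (f (k1 (k2 n))) x - g1 x) + (T2 (f (k1 (k2 n))) x - g2 x))%R.
      by apply/funext => x; rewrite /h /=; ring.
    apply: le_trans.
      apply: energyD_le; first exact: measurable_Rplus.
        by apply: cmeasurableD; [exact: m1|apply: cmeasurableN; case: Lg1].
      by apply: cmeasurableD; [exact: m2|apply: cmeasurableN; case: Lg2].
    rewrite [leRHS](_ : _ = 2%:E * (e / 4)%:E + 2%:E * (e / 4)%:E)//.
    apply: leeD; apply: lee_wpmul2l; rewrite ?lee_fin//; first by near: n; exact: kg1.
    by near: n; exact: kg2.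
Unshelve. all: by end_near. Qed.

End EnergyCompact.

(** * Cauchy-Schwarz with weights *)

Lemma measurable_sqrt {R : realType} (D : set R) : measurable_fun D (@Num.sqrt R).
Proof.
by apply: measurable_funTS; apply: continuous_measurable_fun; exact: sqrt_continuous.
Qed.

Section CauchySchwarz.
Context {R : realType}.
Local Notation mu := (@lebesgue_measure R).
Implicit Types (D : set R).
Local Open Scope ereal_scope.

(** The Cauchy-Schwarz inequality for [sqrt a] and [sqrt b], in a form where the
    weights are distributed freely between the two factors and where either
    integral may be infinite. *)
Lemma integral_sqr_le D (u a b : R -> R) : measurable D ->
  measurable_fun D u -> measurable_fun D a -> measurable_fun D b ->
  (forall x, D x -> 0 <= a x)%R -> (forall x, D x -> 0 <= b x)%R ->
  (forall x, D x -> u x ^+ 2 <= a x * b x)%R ->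
  (\int[mu]_(x in D) `|u x|%:E) ^+ 2 <=
  \int[mu]_(x in D) (a x)%:E * \int[mu]_(x in D) (b x)%:E.
Proof.
move=> mD mu_ ma mb a0 b0 uab.
pose sr (f : R -> R) : R -> R := (fun x => Num.sqrt (f x)) \_ D.
have msr (f : R -> R) : measurable_fun D f -> measurable_fun setT (sr f).
  move=> mf; apply/(measurable_restrictT _ mD).
  by apply: (measurable_comp (F := setT)) => //; exact: measurable_sqrt.
have N2 (f : R -> R) : measurable_fun D f -> (forall x, D x -> 0 <= f x)%R ->
    'N[mu]_2%:E[EFin \o sr f]%E = sqrte (\int[mu]_(x in D) (f x)%:E).
  move=> mf f0; rewrite unlock /= poweR12_sqrt; last first.
    by apply: integral_ge0 => x _; rewrite lee_fin powR_ge0.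
  congr sqrte; rewrite [RHS]integral_mkcond; apply: eq_integral => x _.
  rewrite /sr !patchE; case: ifPn => xD; last by rewrite normr0 powR0.
  rewrite powR_mulrn// ger0_norm ?sqrtr_ge0// sqr_sqrtr//.
  by apply: f0; exact: set_mem.
have half : (2^-1 + 2^-1 = 1 :> R)%R by field.
have := hoelder mu (msr _ ma) (msr _ mb) (ltr0n _ 2) (ltr0n _ 2) half.
rewrite !N2// -sqrteM; last by apply: integral_ge0 => x Dx; rewrite lee_fin a0.
set I := _ * _ => h.
have I0 : 0 <= I.
  by apply: mule_ge0; apply: integral_ge0 => x Dx; rewrite lee_fin ?a0 ?b0.
have {}h : \int[mu]_(x in D) `|u x|%:E <= sqrte I.
  apply: le_trans h; rewrite Lnorm1 [leLHS]integral_mkcond.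
  apply: ge0_le_integral => //.
  - by move=> x _; rewrite patchE; case: ifPn => // _; rewrite lee_fin.
  - apply/(measurable_restrictT _ mD)/measurable_EFinP.
    exact: (measurable_comp (F := setT)).
  - apply/measurable_EFinP; apply: (measurable_comp (F := setT)) => //.
    by apply: measurable_funM; exact: msr.
  - move=> x _; rewrite /sr /= !patchE; case: ifPn => xD; last by rewrite mul0r normr0.
    have Dx := set_mem xD.
    rewrite lee_fin -sqrtrM ?a0// (ger0_norm (sqrtr_ge0 _)) -sqrtr_sqr.
    by apply: ler_wsqrtr; exact: uab.
rewrite -[leRHS](sqr_sqrte I0) !expe2; apply: lee_pmul => //;
  by apply: integral_ge0 => x _; rewrite lee_fin.
Qed.

Lemma integrable_sqr_le D (u a b : R -> R) : measurable D ->
  measurable_fun D u -> measurable_fun D a -> measurable_fun D b ->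
  (forall x, D x -> 0 <= a x)%R -> (forall x, D x -> 0 <= b x)%R ->
  (forall x, D x -> u x ^+ 2 <= a x * b x)%R ->
  \int[mu]_(x in D) (a x)%:E < +oo -> \int[mu]_(x in D) (b x)%:E < +oo ->
  mu.-integrable D (EFin \o u).
Proof.
move=> mD mu_ ma mb a0 b0 uab aoo boo.
apply/integrableP; split; first exact/measurable_EFinP.
have := integral_sqr_le mD mu_ ma mb a0 b0 uab.
have i0 (f : R -> R) : (forall x, D x -> 0 <= f x)%R -> 0 <= \int[mu]_(x in D) (f x)%:E.
  by move=> f0; apply: integral_ge0 => x Dx; rewrite lee_fin f0.
have aboo : \int[mu]_(x in D) (a x)%:E * \int[mu]_(x in D) (b x)%:E < +oo.
  by apply: lte_mul_pinfty => //; rewrite ?i0// ge0_fin_numE ?i0.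
move=> h; rewrite ltNge leye_eq; apply/negP => /eqP E.
by move: h; rewrite (_ : integral _ _ _ = +oo) // expe2 mulyy leNgt aboo.
Qed.

(** The factor 2 comes from applying Cauchy-Schwarz to the real and imaginary
    parts separately. *)
Lemma sqmod_cintegral_le D (h : R -> R[i]) (a b : R -> R) : measurable D ->
  cmeasurable D h -> measurable_fun D a -> measurable_fun D b ->
  (forall x, D x -> 0 <= a x)%R -> (forall x, D x -> 0 <= b x)%R ->
  (forall x, D x -> sqmod (h x) <= a x * b x)%R ->
  (sqmod (cintegral D h))%:E <=
  2%:E * (\int[mu]_(x in D) (a x)%:E * \int[mu]_(x in D) (b x)%:E).
Proof.
move=> mD [mh1 mh2] ma mb a0 b0 hab.
set I := _ * integral _ _ _.
have I0 : 0 <= I.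
  by apply: mule_ge0; apply: integral_ge0 => x Dx; rewrite lee_fin ?a0 ?b0.
have part (u : R -> R) : measurable_fun D u ->
    (forall x, D x -> u x ^+ 2 <= a x * b x)%R ->
    ((\int[mu]_(x in D) u x)%R ^+ 2)%:E <= I.
  move=> mu_ uab.
  apply: le_trans (integral_sqr_le mD mu_ ma mb a0 b0 uab).
  set J := \int[mu]_(x in D) `|u x|%:E.
  have J0 : 0 <= J by apply: integral_ge0 => x _; rewrite lee_fin.
  have [Joo|Joo] := eqVneq J +oo.
    by rewrite Joo expe2 mulyy leey.
  have uJ : `|\int[mu]_(x in D) u x|%R%:E <= J.
    rewrite EFin_normr_Rintegral//.
      by apply: (le_trans (le_abse_integral mu mD _)) => //; exact/measurable_EFinP.
    by apply/integrableP; split; [exact/measurable_EFinP|rewrite ltey].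
  rewrite -real_normK ?num_real// EFin_expe !expe2.
  by apply: lee_pmul => //; rewrite lee_fin.
rewrite (_ : 2%:E * I = I + I); last by rewrite (_ : 2%:E = 1 + 1)// ge0_muleDl// mul1e.
rewrite EFinD; apply: leeD; apply: part => // x Dx.
  by apply: le_trans (hab _ Dx); exact: sqr_Re_le.
by apply: le_trans (hab _ Dx); exact: sqr_Im_le.
Qed.

End CauchySchwarz.

(** * Tonelli on a triangle and the weight y^(-1/2) *)

Section Triangle.
Context {R : realType}.
Local Notation mu := (@lebesgue_measure R).
Local Open Scope ereal_scope.

(** Both sides integrate [a x * b y] over the triangle [0 < y <= x]. *)
Lemma ge0_integral_triangle (a b : R -> R) :
  measurable_fun Rplus a -> measurable_fun Rplus b ->
  (forall x, Rplus x -> 0 <= a x)%R -> (forall x, Rplus x -> 0 <= b x)%R ->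
  \int[mu]_(x in Rplus) ((a x)%:E * \int[mu]_(y in `]0%R, x]) (b y)%:E) =
  \int[mu]_(y in Rplus) ((b y)%:E * \int[mu]_(x in `[y, +oo[) (a x)%:E).
Proof.
move=> ma mb a0 b0.
pose a' : R -> R := a \_ Rplus; pose b' : R -> R := b \_ Rplus.
have patch0 (f : R -> R) : (forall x, Rplus x -> 0 <= f x)%R ->
    forall x, (0 <= (f \_ Rplus) x)%R.
  by move=> f0 x; rewrite patchE; case: ifPn => // /set_mem/f0.
have ma' : measurable_fun setT a' by apply/(measurable_restrictT _ measurable_Rplus).
have mb' : measurable_fun setT b' by apply/(measurable_restrictT _ measurable_Rplus).
pose k (z : R * R) : \bar R := if (z.2 <= z.1)%R then (a' z.1 * b' z.2)%:E else 0.
have mk : measurable_fun setT k.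
  apply: measurable_fun_ifT.
  - by apply: measurable_fun_ler; [exact: measurable_snd|exact: measurable_fst].
  - apply/measurable_EFinP; apply: measurable_funM;
      exact: (measurable_comp (F := setT)).
  - exact: measurable_cst.
have k0 z : 0 <= k z.
  by rewrite /k; case: ifPn => // _; rewrite lee_fin mulr_ge0// patch0.
transitivity (\int[mu]_x \int[mu]_y k (x, y)).
  rewrite integral_mkcond; apply: eq_integral => x _.
  rewrite patchE; case: ifPn => [/set_mem Rx|Rx]; last first.
    rewrite integral0_eq// => y _; rewrite /k /=; case: ifPn => // _.
    by rewrite /a' patchE (negbTE Rx) mul0r.
  rewrite -ge0_integralZl_EFin ?a0//; last 2 first.
  - by move=> y /=; rewrite in_itv /= => /andP[y0 _]; rewrite lee_fin b0// /Rplus /= in_itv /= y0.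
  - apply/measurable_EFinP; apply: measurable_funS mb; first exact: measurable_Rplus.
    by move=> y /=; rewrite /Rplus /= !in_itv /= andbT => /andP[].
  rewrite integral_mkcond; apply: eq_integral => y _.
  rewrite patchE /k /= /a' /b' !patchE (mem_set Rx).
  case: ifPn => [/set_mem|].
    rewrite /= in_itv /= => /andP[y0 ->].
    by rewrite mem_set// /Rplus /= in_itv /= y0.
  move/negP => h; case: ifPn => // yx; case: ifPn => [/set_mem Ry|_]; last by rewrite mulr0.
  exfalso; apply: h; rewrite inE /= in_itv /= yx andbT.
  by move: Ry; rewrite /Rplus /= in_itv /= andbT.
rewrite (@fubini_tonelli _ _ _ _ _ mu mu k mk k0).
rewrite [RHS]integral_mkcond; apply: eq_integral => y _.
rewrite patchE; case: ifPn => [/set_mem Ry|Ry]; last first.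
  rewrite integral0_eq// => x _; rewrite /k /=; case: ifPn => // _.
  by rewrite /b' patchE (negbTE Ry) mulr0.
have y0 : (0 < y)%R by move: Ry; rewrite /Rplus /= in_itv /= andbT.
have sub : `[y, +oo[ `<=` Rplus.
  move=> x /=; rewrite /Rplus /= !in_itv /= !andbT; exact: lt_le_trans.
rewrite -ge0_integralZl_EFin ?b0//; last 2 first.
- by move=> x /sub Rx; rewrite lee_fin a0.
- apply/measurable_EFinP; apply: measurable_funS ma => //; exact: measurable_Rplus.
rewrite [RHS]integral_mkcond; apply: eq_integral => x _.
rewrite patchE /k /= /a' /b' !patchE (mem_set Ry).
case: ifPn => yx; last first.
  case: ifPn => // /set_mem; rewrite /= in_itv /= andbT => xy.
  by rewrite xy in yx.
have xin : [set` `[y, +oo[] x by rewrite /= in_itv /= yx.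
by rewrite (mem_set xin) (mem_set (sub _ xin)) mulrC EFinM.
Qed.

Lemma ge0_integral_bigcup_le (F : (set R)^nat) (f : R -> \bar R) (c : \bar R) :
  nondecreasing_seq F -> (forall n, measurable (F n)) ->
  (forall n, measurable_fun (F n) f) -> (forall n x, F n x -> 0 <= f x) ->
  (forall n, \int[mu]_(x in F n) f x <= c) ->
  \int[mu]_(x in \bigcup_n F n) f x <= c.
Proof.
move=> ndF mF mf f0 Fc.
have h := ge0_nondecreasing_set_cvg_integral (mu := mu) ndF mF mf f0.
rewrite -(cvg_lim _ h)//; apply: lime_le; first by apply/cvg_ex; eexists; exact: h.
by near=> n; exact: Fc.
Unshelve. all: by end_near. Qed.

Lemma integral_le_cst (D : set R) (f : R -> R) (c : R) : measurable D ->
  measurable_fun D f -> (forall x, D x -> 0 <= f x)%R ->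
  (forall x, D x -> f x <= c)%R ->
  \int[mu]_(x in D) (f x)%:E <= c%:E * mu D.
Proof.
move=> mD mf f0 fc; rewrite -integral_cst//.
by apply: ge0_le_integral => //; exact/measurable_EFinP.
Qed.

End Triangle.

Section Weights.
Context {R : realType}.
Local Notation mu := (@lebesgue_measure R).

Lemma measurable_inv_sqrt (D : set R) : measurable D -> D `<=` Rplus ->
  measurable_fun D (fun y : R => (Num.sqrt y)^-1).
Proof.
move=> mD DR.
have mRp : measurable_fun Rplus (fun y : R => (Num.sqrt y)^-1).
  apply: open_continuous_measurable_fun; first exact: interval_open.
  move=> y; rewrite inE /Rplus /= in_itv /= andbT => y0.
  apply: continuousV; first by rewrite gt_eqF// sqrtr_gt0.
  exact: sqrt_continuous.
exact: (measurable_funS measurable_Rplus DR mRp).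
Qed.

(** The pieces ]x / 4^(n+1), x / 4^n] contribute at most [2 sqrt x / 2^n] each;
    the partial sums telescope to [4 sqrt x (1 - 2^-n)]. *)
Lemma integral_inv_sqrt_le (x : R) : 0 < x ->
  (\int[mu]_(y in `]0%R, x]) (Num.sqrt y)^-1%:E <= (4 * Num.sqrt x)%:E)%E.
Proof.
move=> x0; set s := Num.sqrt x.
have s0 : 0 < s by rewrite sqrtr_gt0.
have xs : x = s ^+ 2 by rewrite sqr_sqrtr// ltW.
have q0 n : (0 < 2^-1 ^+ n :> R) by rewrite exprn_gt0.
have sq0 n : 0 <= s * 2^-1 ^+ n by rewrite mulr_ge0// ltW.
(* [e n = x / 4 ^ n] *)
pose e n : R := (s * 2^-1 ^+ n) ^+ 2.
have e0 n : 0 < e n by rewrite exprn_gt0// mulr_gt0.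
have ele n : e n.+1 <= e n.
  rewrite /e ler_sqr ?nnegrE// ler_pM2l// exprS.
  by apply: ler_piMl; rewrite ?(ltW (q0 n))// invf_le1// ler1n.
have ele0 n : e n <= x.
  elim: n => [|n ih]; first by rewrite /e expr0 mulr1 xs.
  exact: le_trans (ele n) ih.
pose F n : set R := `]e n, x]%classic.
have FR n : F n `<=` Rplus.
  by move=> y; rewrite /F /Rplus /= !in_itv /= andbT => /andP[/(lt_trans (e0 n))].
have mF n : measurable_fun (F n) (fun y : R => ((Num.sqrt y)^-1)%:E).
  by apply/measurable_EFinP; exact: measurable_inv_sqrt (measurable_itv _) (FR n).
have -> : `]0%R, x]%classic = \bigcup_n F n.
  apply/seteqP; split => [y|y [n _]]; rewrite /F /= !in_itv /=; last first.
    by move=> /andP[ey ->]; rewrite (lt_trans (e0 n) ey).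
  move=> /andP[y0 yx].
  have /cvgrPdist_lt/(_ _ y0)[n _ /(_ n (leqnn n))] : e n @[n --> \oo] --> 0.
    have -> : e = (fun n => x * (4^-1) ^+ n).
      apply/funext => n; rewrite /e exprMn -xs -!exprM mulnC exprM.
      by congr (_ * _ ^+ _); rewrite exprVn; congr (_^-1); ring.
    rewrite -[X in _ --> X](mulr0 x); apply: cvgMr; apply: cvg_expr.
    by rewrite ger0_norm ?invr_ge0// invf_lt1// ltr1n.
  rewrite sub0r normrN ger0_norm ?ltW// => eny.
  by exists n => //; rewrite /F /= in_itv /= eny yx.
apply: ge0_integral_bigcup_le => //.
- apply/nondecreasing_seqP => n; rewrite subsetEset /F => y /=.
  by rewrite !in_itv /= => /andP[ey ->]; rewrite (le_lt_trans (ele n)).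
- by move=> n; exact: measurable_itv.
move=> n; apply: (@le_trans _ _ (4 * s * (1 - 2^-1 ^+ n))%:E); last first.
  by rewrite lee_fin; apply: ler_piMr; rewrite ?gerBl ?(ltW (q0 n))// mulr_ge0// ltW.
elim: n => [|n ih].
  by rewrite /F /e !expr0 mulr1 -xs set_itvoc0 integral_set0 subrr mulr0.
have -> : F n.+1 = `]e n.+1, e n] `|` F n.
  by rewrite /F -itv_bndbnd_setU// bnd_simp.
rewrite ge0_integral_setU//=; last 3 first.
- exact: measurable_itv.
- rewrite /F -itv_bndbnd_setU ?bnd_simp//; exact: mF.
- apply/disj_set2P; rewrite -subset0 => y /=; rewrite /F /= !in_itv /=.
  by move=> [/andP[_ +] /andP[+ _]] => /le_lt_trans h /h; rewrite ltxx.
apply: (@le_trans _ _ ((2 * s * 2^-1 ^+ n)%:E + (4 * s * (1 - 2^-1 ^+ n))%:E)%E); last first.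
  rewrite -EFinD lee_fin exprS le_eqVlt; apply/orP; left; apply/eqP; by field.
apply: leeD => //.
apply: le_trans; first apply: (@integral_le_cst _ _ _ (s * 2^-1 ^+ n.+1)^-1) => //.
- apply: measurable_inv_sqrt => // y.
  by rewrite /Rplus /= !in_itv /= andbT => /andP[/(lt_trans (e0 _))].
- move=> y; rewrite /= in_itv /= => /andP[ey _].
  rewrite lef_pV2 ?posrE ?mulr_gt0 ?sqrtr_gt0//; last exact: lt_trans ey.
  by rewrite -[leLHS](ger0_norm (sq0 _)) -sqrtr_sqr; apply/ler_wsqrtr/ltW.
- have : (mu `]e n.+1, e n] <= (e n)%:E)%E.
    rewrite lebesgue_measure_itv /=; case: ifPn => _; last by rewrite lee_fin (ltW (e0 n)).
    by rewrite -EFinB lee_fin gerBl (ltW (e0 _)).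
  move=> h; apply: (@le_trans _ _ ((s * 2^-1 ^+ n.+1)^-1%:E * (e n)%:E)%E).
    by apply: lee_wpmul2l h; rewrite lee_fin invr_ge0.
  rewrite -EFinM lee_fin /e (exprS _ n) le_eqVlt; apply/orP; left; apply/eqP.
  have := q0 n; set t := 2^-1 ^+ n => t0.
  by field; rewrite !gt_eqF.

Qed.

End Weights.

(** * Weighted tails and Hardy inequalities *)

Section DyadicTail.
Context {R : realType}.
Local Notation mu := (@lebesgue_measure R).
Implicit Types (p : R -> R) (D : R).

Definition dyadic_bound p D := forall n : int,
  ((2 ^ n)%:E * \int[mu]_(x in `[2 ^ n, 2 ^ (n + 1)]) (p x)%:E <= D%:E)%E.

Definition sqrt_tail p (y : R) : \bar R :=
  \int[mu]_(x in `[y, +oo[) (Num.sqrt x * p x)%:E.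

Lemma exp2z_gt0 (n : int) : 0 < (2 : R) ^ n.
Proof. by rewrite exprz_gt0. Qed.

Lemma exp2zS (n : int) : (2 : R) ^ (n + 1) = 2 * 2 ^ n.
Proof. by rewrite expfzDr// expr1z mulrC. Qed.

Lemma dyadic_floor (y : R) : 0 < y -> exists m : int, 2 ^ m <= y < 2 ^ (m + 1).
Proof.
move=> y0; have l2 : 0 < ln (2 : R) by rewrite ln_gt0// ltr1n.
pose m := Num.floor (ln y / ln 2); exists m.
have /andP[h1 h2] : m%:~R <= ln y / ln 2 < (m + 1)%:~R := Num.Theory.floor_itv _.
rewrite -!powR_intmul// /powR pnatr_eq0 /=.
rewrite -[in X in _ <= X](lnK y0) -[in X in X < _](lnK y0) ler_expR ltr_expR.
by rewrite -ler_pdivlMr// h1 -ltr_pdivrMr.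
Qed.

Lemma integral_dyadic_le p D (n : int) : (forall x, Rplus x -> 0 <= p x) ->
  measurable_fun Rplus p -> dyadic_bound p D ->
  (\int[mu]_(x in `[2 ^ n, 2 ^ (n + 1)[) (Num.sqrt x * p x)%:E <=
   (Num.sqrt 2 * D * (Num.sqrt (2 ^ n))^-1)%:E)%E.
Proof.
move=> p0 mp pD.
have t0 := exp2z_gt0 n; set t := 2 ^ n in t0 *.
have sub : `[t, 2 ^ (n + 1)] `<=` Rplus.
  move=> x; rewrite /Rplus /= !in_itv /= andbT => /andP[+ _]; exact: lt_le_trans.
have mp' : measurable_fun `[t, 2 ^ (n + 1)] p.
  exact: measurable_funS measurable_Rplus sub mp.
have msp : measurable_fun `[t, 2 ^ (n + 1)] (fun x => Num.sqrt x * p x).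
  by apply: measurable_funM => //; exact: measurable_sqrt.
apply: (@le_trans _ _ (\int[mu]_(x in `[t, (2 ^ (n + 1))%R]) (Num.sqrt x * p x)%:E)%E).
  apply: ge0_subset_integral => //=.
  - exact/measurable_EFinP.
  - by move=> x /sub Rx; rewrite lee_fin mulr_ge0 ?p0.
  - by apply: subset_itvl; rewrite bnd_simp.
apply: (@le_trans _ _ ((Num.sqrt (2 * t))%:E *
    \int[mu]_(x in `[t, (2 ^ (n + 1))%R]) (p x)%:E)%E).
  rewrite -ge0_integralZl_EFin//; last 2 first.
  - by move=> x /sub Rx; rewrite lee_fin p0.
  - exact/measurable_EFinP.
  apply: ge0_le_integral => //.
  - by move=> x /sub Rx; rewrite lee_fin mulr_ge0 ?p0.
  - exact/measurable_EFinP.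
  - by apply/measurable_EFinP; apply: measurable_funM.
  - move=> x xt; rewrite -EFinM lee_fin; apply: ler_wpM2r; first exact/p0/sub.
    apply: ler_wsqrtr; rewrite -exp2zS.
    by move: xt; rewrite /= in_itv /= => /andP[].
have {}pD := pD n; rewrite -/t in pD.
have st0 : 0 < Num.sqrt t by rewrite sqrtr_gt0.
rewrite sqrtrM// (_ : Num.sqrt 2 * Num.sqrt t = Num.sqrt 2 * (Num.sqrt t)^-1 * t); last first.
  rewrite -[X in _ * _ * X]sqr_sqrtr; last exact: ltW.
  by field; rewrite gt_eqF.
rewrite EFinM -muleA (_ : _ * D * _ = Num.sqrt 2 * (Num.sqrt t)^-1 * D); last by ring.
by rewrite [leRHS]EFinM; apply: lee_wpmul2l => //; rewrite lee_fin mulr_ge0// invr_ge0.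
Qed.

(** The dyadic block starting at [2^n] contributes at most [sqrt 2 * D * r n] with
    [r n = 2^(-n/2)] ([integral_dyadic_le]).  Since [r] is geometric of ratio
    [1 / sqrt 2] this is below [6 D (r n - r (n+1))], and the blocks telescope. *)
Lemma sqrt_tail_le p D (y : R) : (forall x, Rplus x -> 0 <= p x) ->
  measurable_fun Rplus p -> 0 <= D -> dyadic_bound p D -> 0 < y ->
  (sqrt_tail p y <= (12 * D / Num.sqrt y)%:E)%E.
Proof.
move=> p0 mp D0 pD y0; have [m /andP[my ym]] := dyadic_floor y0.
pose r (n : int) : R := (Num.sqrt (2 ^ n))^-1.
have s20 : 0 < Num.sqrt (2 : R) by rewrite sqrtr_gt0.
have s2sq : Num.sqrt (2 : R) ^+ 2 = 2 by rewrite sqr_sqrtr.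
have r0 n : 0 < r n by rewrite invr_gt0 sqrtr_gt0 exp2z_gt0.
have rS n : r n = Num.sqrt 2 * r (n + 1).
  rewrite /r exp2zS sqrtrM// invfM mulrA divff ?mul1r// gt_eqF//.
pose F (N : nat) : set R := `[2 ^ m, 2 ^ (m + N%:Z)[%classic.
have FR N : F N `<=` Rplus.
  move=> x; rewrite /F /Rplus /= !in_itv /= andbT => /andP[+ _].
  exact/lt_le_trans/exp2z_gt0.
have mf : measurable_fun Rplus (fun x => (Num.sqrt x * p x)%:E).
  apply/measurable_EFinP; apply: measurable_funM => //; exact: measurable_sqrt.
have f0 x : Rplus x -> (0 <= (Num.sqrt x * p x)%:E)%E.
  by move=> Rx; rewrite lee_fin mulr_ge0 ?p0.
have le2 (N : nat) : (2 : R) ^ (m + N%:Z) <= 2 ^ (m + N.+1%:Z).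
  by rewrite ler_eXz2l ?ltr1n// lerD2l lez_nat.
apply: (@le_trans _ _ (\int[mu]_(x in \bigcup_N F N) (Num.sqrt x * p x)%:E)%E).
  have mU : measurable (\bigcup_N F N).
    by apply: bigcup_measurable => N _; exact: measurable_itv.
  apply: ge0_subset_integral => //.
  - apply: measurable_funS mf; first exact: measurable_Rplus.
    by move=> x [N _ /FR].
  - by move=> x [N _ /FR]; exact: f0.
  - move=> x /=; rewrite in_itv /= andbT => yx.
    have x0 : 0 < x by exact: lt_le_trans yx.
    have [k /andP[kx xk]] := dyadic_floor x0.
    exists (absz (k + 1 - m)%R) => //; rewrite /F /= in_itv /= (le_trans my yx) /=.
    apply: lt_le_trans xk _; rewrite ler_eXz2l ?ltr1n//.
    by rewrite -lerBlDl abszE ler_norm.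
apply: (@le_trans _ _ (6 * D * r m)%:E); last first.
  rewrite lee_fin rS.
  have : r (m + 1) <= (Num.sqrt y)^-1.
    rewrite /r lef_pV2 ?posrE ?sqrtr_gt0 ?exp2z_gt0//.
    by apply/ler_wsqrtr/ltW.
  move=> h.
  have s2 : Num.sqrt (2 : R) <= 2.
    by rewrite -[leRHS](ger0_norm (ler0n _ 2)) -sqrtr_sqr ler_wsqrtr// expr2 -natrM ler_nat.
  rewrite (_ : 12 * D / _ = 6 * D * (2 / Num.sqrt y)); last by ring.
  apply: ler_wpM2l; first by rewrite mulr_ge0.
  by apply: ler_pM => //; rewrite ltW.
apply: ge0_integral_bigcup_le.
- apply/nondecreasing_seqP => N; rewrite subsetEset /F.
  by apply: subset_itvl; rewrite bnd_simp.
- by move=> N; exact: measurable_itv.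
- by move=> N; exact: measurable_funS measurable_Rplus (FR N) mf.
- by move=> N x /FR; exact: f0.
move=> N; apply: (@le_trans _ _ (6 * D * (r m - r (m + N%:Z)))%:E); last first.
  by rewrite lee_fin; apply: ler_wpM2l; rewrite ?mulr_ge0// gerBl ltW.
elim: N => [|N ih].
  by rewrite /F addr0 set_itvco0 integral_set0 subrr mulr0.
have FS : F N.+1 = F N `|` `[2 ^ (m + N%:Z), 2 ^ (m + N.+1%:Z)[.
  rewrite /F -itv_bndbnd_setU// bnd_simp//.
  by rewrite ler_eXz2l ?ltr1n// lerDl.
have FUR := FR N.+1; rewrite FS in FUR.
rewrite FS ge0_integral_setU//=; last 4 first.
- exact: measurable_itv.
- exact: measurable_funS measurable_Rplus FUR mf.
- by move=> x /FUR; exact: f0.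
- apply/disj_set2P; rewrite -subset0 => x /=; rewrite /F /= !in_itv /=.
  by move=> [/andP[_ +] /andP[+ _]] => /lt_le_trans h /h; rewrite ltxx.
have mS : m + N.+1%:Z = m + N%:Z + 1 by rewrite -addrA -addn1 PoszD.
rewrite mS; set n := m + N%:Z in ih *.
apply: le_trans; first by apply: leeD; [exact: ih|exact: integral_dyadic_le].
rewrite -EFinD lee_fin -/(r n) (rS n) -subr_ge0.
set s := Num.sqrt 2 in s20 s2sq *.
rewrite (_ : _ - _ = D * r (n + 1) * (6 * s - 6 - s ^+ 2)); last by ring.
rewrite mulr_ge0 ?mulr_ge0 ?(ltW (r0 _))// s2sq.
have : 4 / 3 <= s by rewrite -(ler_sqr (x := 4/3)) ?nnegrE ?ltW// s2sq; lra.
lra.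
Qed.

End DyadicTail.

Section Hardy.
Context {R : realType}.
Local Notation mu := (@lebesgue_measure R).
Implicit Types (phi f : R -> R[i]) (D : R) (E : set R).

(** The supremum over simple functions that defines the integral grows with the
    integrand and with the domain; in this form monotonicity applies directly to
    integrands which are themselves integrals. *)
Lemma ge0_le_integral_subset E E' (f g : R -> \bar R) : E `<=` E' ->
  (forall x, E x -> 0 <= f x)%E -> (forall x, E' x -> 0 <= g x)%E ->
  (forall x, E x -> f x <= g x)%E ->
  (\int[mu]_(x in E) f x <= \int[mu]_(x in E') g x)%E.
Proof.
move=> EE' f0 g0 fg; rewrite !ge0_integralE//.
apply: le_ereal_sup => _ [h hf <-]; exists h => // x; apply: le_trans (hf x) _.
rewrite !patchE; case: ifPn => [/set_mem Ex|_].
  by rewrite mem_set ?fg//; exact: EE'.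
by case: ifPn => // /set_mem /g0.
Qed.

Definition lower_int f (x : R) : R[i] := cintegral `]0, x[ f.
Definition upper_int phi f (x : R) : R[i] :=
  cintegral `[x, +oo[ (fun y => phi y * f y).

Lemma itv0oo_sub_Rplus (x : R) : `]0%R, x[ `<=` Rplus.
Proof. by move=> y; rewrite /Rplus /= !in_itv /= andbT => /andP[]. Qed.

Lemma itv0oc_sub_Rplus (x : R) : `]0%R, x] `<=` Rplus.
Proof. by move=> y; rewrite /Rplus /= !in_itv /= andbT => /andP[]. Qed.

Lemma itvcy_sub_Rplus (x : R) : 0 < x -> `[x, +oo[ `<=` Rplus.
Proof. by move=> x0 y; rewrite /Rplus /= !in_itv /= !andbT; exact: lt_le_trans. Qed.

Lemma in_Rplus (x : R) : Rplus x <-> 0 < x.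
Proof. by rewrite /Rplus /= in_itv /= andbT. Qed.

(** Weights [y^(-1/2)] and [y^(1/2)|f|^2] in Cauchy-Schwarz; after Tonelli the
    inner integral is a weighted tail of [|phi|^2].  The constant is
    [96 = 2 * 4 * 12]. *)
Lemma hardy_lower phi f D : cmeasurable Rplus phi -> cmeasurable Rplus f ->
  0 <= D -> dyadic_bound (fun x => sqmod (phi x)) D ->
  (energy Rplus (fun x => phi x * lower_int f x)%R <=
   (96 * D)%:E * energy Rplus f)%E.
Proof.
move=> mphi mf D0 phiD.
have mp := measurable_sqmod mphi; have mq := measurable_sqmod mf.
have msqrt := @measurable_sqrt R Rplus.
pose a (x : R) := 8 * (Num.sqrt x * sqmod (phi x)).
pose b (y : R) := Num.sqrt y * sqmod (f y).
have a0 x : 0 <= a x by rewrite mulr_ge0// mulr_ge0// sqmod_ge0.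
have b0 x : 0 <= b x by rewrite mulr_ge0// sqmod_ge0.
have ma : measurable_fun Rplus a.
  by apply: measurable_funM => //; exact: measurable_funM.
have mb : measurable_fun Rplus b by exact: measurable_funM.
apply: (@le_trans _ _ (\int[mu]_(x in Rplus)
    ((a x)%:E * \int[mu]_(y in `]0%R, x]) (b y)%:E))%E).
  apply: ge0_le_integral_subset => //.
  - by move=> x _; rewrite lee_fin sqmod_ge0.
  - by move=> x _; rewrite mule_ge0 ?lee_fin// integral_ge0// => y _; rewrite lee_fin.
  move=> x /in_Rplus x0; rewrite sqmodM EFinM /a.
  rewrite (_ : 8 * _ = sqmod (phi x) * (2 * (4 * Num.sqrt x))); last by ring.
  rewrite EFinM -muleA; apply: lee_wpmul2l; first by rewrite lee_fin sqmod_ge0.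
  have sub := @itv0oo_sub_Rplus x.
  apply: le_trans.
    apply: (@sqmod_cintegral_le _ _ _ (fun y => (Num.sqrt y)^-1) b) => //.
    - exact: cmeasurableS measurable_Rplus sub mf.
    - exact: measurable_inv_sqrt.
    - exact: measurable_funS measurable_Rplus sub mb.
    - move=> y /sub/in_Rplus y0; rewrite /b mulrA mulVf ?mul1r//.
      by rewrite gt_eqF// sqrtr_gt0.
  rewrite EFinM -muleA; apply: lee_wpmul2l => //.
  have sub2 : `]0%R, x[ `<=` `]0%R, x] by apply: subset_itvl; rewrite bnd_simp.
  apply: lee_pmul.
  - by apply: integral_ge0 => y _; rewrite lee_fin.
  - by apply: integral_ge0 => y _; rewrite lee_fin.
  - apply: le_trans (integral_inv_sqrt_le x0).
    by apply: ge0_le_integral_subset => // y _; rewrite lee_fin.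
  - by apply: ge0_le_integral_subset => // y _; rewrite lee_fin.
rewrite ge0_integral_triangle// -ge0_integralZl_EFin ?mulr_ge0//; last 2 first.
- by move=> x _; rewrite lee_fin sqmod_ge0.
- exact/measurable_EFinP.
apply: ge0_le_integral_subset => //.
- by move=> y _; rewrite mule_ge0 ?lee_fin// integral_ge0// => x _; rewrite lee_fin.
- by move=> y _; rewrite -EFinM lee_fin !mulr_ge0// sqmod_ge0.
move=> y /in_Rplus y0.
have sub := itvcy_sub_Rplus y0.
under eq_integral do rewrite EFinM.
rewrite ge0_integralZl_EFin//; last 2 first.
- by move=> x _; rewrite lee_fin mulr_ge0// sqmod_ge0.
- apply/measurable_EFinP; apply: measurable_funS measurable_Rplus sub _.
  exact: measurable_funM.
have h := sqrt_tail_le (fun x _ => sqmod_ge0 (phi x)) mp D0 phiD y0.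
apply: (@le_trans _ _ ((b y)%:E * (8%:E * (12 * D / Num.sqrt y)%:E))%E).
  by apply: lee_wpmul2l; rewrite ?lee_fin//; apply: lee_wpmul2l.
rewrite -!EFinM lee_fin /b le_eqVlt; apply/orP; left; apply/eqP.
by field; rewrite gt_eqF// sqrtr_gt0.
Unshelve. all: exact: measurable_Rplus. Qed.

(** The weights are exchanged: [y^(1/2)|phi|^2] and [y^(-1/2)|f|^2].  The output
    is only integrated over a set [E] on which the tails are controlled, so
    that the same statement yields boundedness and smallness far away. *)
Lemma hardy_upper phi f E (e : R) : cmeasurable Rplus phi -> cmeasurable Rplus f ->
  E `<=` Rplus -> 0 <= e ->
  (forall x, E x -> (sqrt_tail (fun y => sqmod (phi y)) x <= (e / Num.sqrt x)%:E)%E) ->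
  (energy E (upper_int phi f) <= (8 * e)%:E * energy Rplus f)%E.
Proof.
move=> mphi mf ER e0 tail.
have mp := measurable_sqmod mphi; have mq := measurable_sqmod mf.
have msqrt := @measurable_sqrt R Rplus.
have misqrt := @measurable_inv_sqrt R Rplus (measurable_Rplus) (@subset_refl _ _).
pose a (y : R) := (Num.sqrt y)^-1 * sqmod (f y).
pose b (x : R) := 2 * e * (Num.sqrt x)^-1.
have a0 x : 0 <= a x by rewrite mulr_ge0// sqmod_ge0.
have b0 x : 0 <= b x by rewrite !mulr_ge0.
have ma : measurable_fun Rplus a by exact: measurable_funM.
have mb : measurable_fun Rplus b by exact: measurable_funM.
apply: (@le_trans _ _ (\int[mu]_(x in Rplus)
    ((b x)%:E * \int[mu]_(y in `[x, +oo[) (a y)%:E))%E).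
  apply: ge0_le_integral_subset => //.
  - by move=> x _; rewrite lee_fin sqmod_ge0.
  - by move=> x _; rewrite mule_ge0 ?lee_fin// integral_ge0// => y _; rewrite lee_fin.
  move=> x Ex; have /in_Rplus x0 := ER _ Ex.
  have sub := itvcy_sub_Rplus x0.
  apply: le_trans.
    apply: (@sqmod_cintegral_le _ _ _ (fun y => Num.sqrt y * sqmod (phi y)) a) => //.
    - by apply: cmeasurableS measurable_Rplus sub _; exact: cmeasurableM.
    - by apply: measurable_funS measurable_Rplus sub _; exact: measurable_funM.
    - exact: measurable_funS measurable_Rplus sub ma.
    - by move=> y _; rewrite mulr_ge0// sqmod_ge0.
    - move=> y /sub/in_Rplus y0; rewrite /a sqmodM mulrACA divff ?mul1r//.
      by rewrite gt_eqF// sqrtr_gt0.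
  rewrite /b -mulrA EFinM -muleA; apply: lee_wpmul2l => //.
  apply: lee_wpmul2r; last exact: tail.
  by apply: integral_ge0 => y _; rewrite lee_fin.
rewrite -ge0_integral_triangle// -ge0_integralZl_EFin ?mulr_ge0//; last 2 first.
- by move=> x _; rewrite lee_fin sqmod_ge0.
- exact/measurable_EFinP.
apply: ge0_le_integral_subset => //.
- by move=> y _; rewrite mule_ge0 ?lee_fin// integral_ge0// => x _; rewrite lee_fin.
- by move=> y _; rewrite -EFinM lee_fin !mulr_ge0// sqmod_ge0.
move=> y /in_Rplus y0.
have sub := @itv0oc_sub_Rplus y.
under eq_integral do rewrite EFinM.
rewrite ge0_integralZl_EFin ?mulr_ge0//; last first.
  by apply/measurable_EFinP; exact: measurable_inv_sqrt.
apply: (@le_trans _ _ ((a y)%:E * ((2 * e)%:E * (4 * Num.sqrt y)%:E))%E).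
  apply: lee_wpmul2l; rewrite ?lee_fin//; apply: lee_wpmul2l; rewrite ?lee_fin ?mulr_ge0//.
  exact: integral_inv_sqrt_le.
rewrite -!EFinM lee_fin /a le_eqVlt; apply/orP; left; apply/eqP.
by field; rewrite gt_eqF// sqrtr_gt0.
Unshelve. all: exact: measurable_Rplus. Qed.

End Hardy.

(** * Pointwise convergent subsequences *)

Section DiagonalSubsequence.
Context {R : realType}.

(** Sequential compactness of a countable product of segments: a cluster point
    exists by Tychonoff, and only finitely many coordinates matter at a time. *)
Lemma bounded_nat_cluster (h : nat -> nat -> R) (B : nat -> R) :
  (forall n i, `|h n i| <= B i) ->
  exists g : nat -> R, forall (N m : nat) (e : R), 0 < e ->
    exists n, (N <= n)%N /\ forall i, (i < m)%N -> `|h n i - g i| < e.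
Proof.
move=> hB.
pose A i : set R := `[- B i, B i]%classic.
have := @tychonoff nat (fun=> R) A (fun i => @segment_compact _ _ _).
set K := [set f | _] => cK.
have KF : (h @ \oo) K.
  by exists 0%N => // n _ i; rewrite /A /= in_itv /= -ler_norml.
have [g [_ clg]] := cK _ _ KF.
exists g => N m e e0.
have nb : nbhs (g : prod_topology (fun=> R))
    [set f : prod_topology (fun=> R) | forall i, (i < m)%N -> `|f i - g i| < e].
  elim: m => [|m ih].
    by apply: filterE => f i; rewrite ltn0.
  have : nbhs (g : prod_topology (fun=> R))
      [set f : prod_topology (fun=> R) | `|f m - g m| < e].
    have pc := @proj_continuous nat (fun=> R) m g.
    have nbm : nbhs (proj m g) [set x : R | `|x - g m| < e].
      have := @nbhsx_ballx R R (g m) e e0; apply: filterS => x.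
      by rewrite /ball /= distrC.
    exact: (pc _ nbm).
  move=> h2; apply: filterS (filterI ih h2) => f [f1 f2] i.
  by rewrite ltnS leq_eqVlt => /predU1P[->//|]; exact: f1.
have tail : (h @ \oo) [set f | exists2 n, (N <= n)%N & f = h n].
  by exists N => // n Nn; exists n.
by have [f [[n Nn ->] fm]] := clg _ _ tail nb; exists n.
Qed.

(** Diagonal choice: the [n]-th term is [1 / (n+1)]-close to the cluster point on
    the first [n] coordinates. *)
Lemma pointwise_subsequence (I : countType) (h : nat -> I -> R) (B : I -> R) :
  (forall n i, `|h n i| <= B i) ->
  exists2 k : nat -> nat, {homo k : m n / (m < n)%N} &
    forall i, exists l : R, h (k n) i @[n --> \oo] --> l.
Proof.
move=> hB.
pose h' n j := if unpickle j is Some i then h n i else 0 : R.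
pose B' j := if @unpickle I j is Some i then B i else 0 : R.
have [|g gh] := @bounded_nat_cluster h' B'.
  by move=> n j; rewrite /h' /B'; case: unpickle => [i|]; rewrite ?normr0.
have /choice[F FP] : forall Nm : nat * nat, exists n, (Nm.1 <= n)%N /\
    forall i, (i < Nm.2)%N -> `|h' n i - g i| < Nm.2.+1%:R^-1.
  by move=> [N m]; apply: gh; rewrite invr_gt0.
pose k := fix k n := if n is n'.+1 then F ((k n').+1, n'.+1) else F (0, 0)%N.
exists k.
  apply: homo_ltn; first exact: ltn_trans.
  by move=> n; have [] := FP ((k n).+1, n.+1).
move=> i; exists (g (pickle i)).
have hi n : h n i = h' n (pickle i) by rewrite /h' pickleK.
under eq_fun do rewrite hi.
apply/cvgrPdist_lt => e e0; near=> n; rewrite distrC.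
have [n' nE] : exists n', n = n'.+1.
  exists n.-1; rewrite prednK//; near: n; exact: nbhs_infty_gt.
have [_] := FP ((k n').+1, n'.+1); rewrite -[F _]/(k n'.+1) -nE /= => /(_ (pickle i)).
move=> /(_ _)/lt_trans; apply.
  by near: n; exact: nbhs_infty_gt.
by near: n; exact: near_infty_natSinv_lt (PosNum e0).
Unshelve. all: by end_near. Qed.

End DiagonalSubsequence.

Section PointwiseLimits.
Context {R : realType}.
Local Notation mu := (@lebesgue_measure R).

(** The modulus of continuity is measured through a continuous function [w], the
    same for the whole sequence; convergence at positive rationals then
    propagates to every positive point.  The boolean separates real and
    imaginary parts. *)
Lemma equicontinuous_subsequence (h : nat -> bool -> R -> R) (B : R -> R) (w : R -> R) :
  (forall n b x, 0 < x -> `|h n b x| <= B x) ->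
  (forall x, 0 < x -> {for x, continuous w}) ->
  (forall n b x y, 0 < x -> 0 < y -> (h n b x - h n b y) ^+ 2 <= `|w x - w y|) ->
  exists2 k : nat -> nat, {homo k : m n / (m < n)%N} &
    forall b x, 0 < x -> exists l : R, h (k n) b x @[n --> \oo] --> l.
Proof.
move=> hB cw hw.
pose hq n (i : bool * rat) := if 0 < ratr i.2 :> R then h n i.1 (ratr i.2) else 0.
pose Bq (i : bool * rat) := if 0 < ratr i.2 :> R then B (ratr i.2) else 0.
have [|k kinc kq] := @pointwise_subsequence R _ hq Bq.
  by move=> n [b q]; rewrite /hq /Bq /=; case: ifPn => q0; [exact: hB|rewrite normr0].
exists k => // b x x0.
suff : cvg (h (k n) b x @[n --> \oo]) by move=> /cvg_ex.
apply: cauchy_cvg; apply: cauchy_exP => e e0.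
have e20 : 0 < (e / 2) ^+ 2 by rewrite exprn_gt0// divr_gt0.
have /cvgrPdist_lt/(_ _ e20)[d /= d0 wd] := cw x x0.
have xd : x < x + d by rewrite ltrDl.
have [q] := rat_in_itvoo xd; rewrite in_itv /= => /andP[xq qd].
have q0 : 0 < ratr q :> R by exact: lt_trans xq.
have [l] := kq (b, q); rewrite /hq /= q0 => /cvgrPdist_lt hl.
exists l; have e2 : 0 < e / 2 by rewrite divr_gt0.
have [N _ Nl] := hl _ e2.
exists N => // n Nn /=; rewrite /ball /=.
have h1 : `|h (k n) b (ratr q) - h (k n) b x| < e / 2.
  rewrite -ltr_sqr ?nnegrE ?(ltW e2)// real_normK ?num_real//.
  apply: le_lt_trans (hw _ _ _ _ q0 x0) _; rewrite distrC; apply: wd => /=.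
  by rewrite distrC gtr0_norm ?subr_gt0// ltrBlDl.
rewrite (splitr e) -(subrKA (h (k n) b (ratr q))).
apply: le_lt_trans (ler_normD _ _) _; apply: ltrD => //.
exact: Nl.
Qed.

Local Open Scope ereal_scope.

Lemma limn_einf_le (u : nat -> \bar R) (c : \bar R) :
  (forall n, u n <= c) -> limn_einf u <= c.
Proof.
move=> uc; rewrite limn_einf_lim; apply: lime_le; first exact: is_cvg_einfs.
near=> n; apply: le_trans (uc n).
by apply: ereal_inf_lbound; exists n => /=.
Unshelve. all: by end_near. Qed.

Definition ccvg (u : nat -> R[i]) (l : R[i]) :=
  complex.Re (u n) @[n --> \oo] --> complex.Re l /\
  complex.Im (u n) @[n --> \oo] --> complex.Im l.

Lemma ccvgMr (c : R[i]) u l : ccvg u l -> ccvg (fun n => c * u n)%R (c * l)%R.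
Proof.
move=> [ur ui]; rewrite /ccvg ReCM ImCM; split.
- rewrite (_ : (fun n => _) = fun n => (complex.Re c * complex.Re (u n) -
    complex.Im c * complex.Im (u n))%R); last by apply/funext => n; rewrite ReCM.
  by apply: cvgB; exact: cvgMr.
- rewrite (_ : (fun n => _) = fun n => (complex.Re c * complex.Im (u n) +
    complex.Im c * complex.Re (u n))%R); last by apply/funext => n; rewrite ImCM.
  by apply: cvgD; exact: cvgMr.
Qed.

Lemma ccvg_sub0 u l : ccvg u l -> ccvg (fun n => u n - l)%R 0%R.
Proof.
move=> [ur ui]; split.
- rewrite (_ : (fun n => _) = fun n => (complex.Re (u n) - complex.Re l)%R); last first.
    by apply/funext => n; rewrite ReCD ReCN.
  by rewrite -[X in _ --> X](subrr (complex.Re l)); apply: cvgB => //; exact: cvg_cst.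
- rewrite (_ : (fun n => _) = fun n => (complex.Im (u n) - complex.Im l)%R); last first.
    by apply/funext => n; rewrite ImCD ImCN.
  by rewrite -[X in _ --> X](subrr (complex.Im l)); apply: cvgB => //; exact: cvg_cst.
Qed.

Lemma sqmod_cvg (u : nat -> R[i]) (l : R[i]) : ccvg u l ->
  sqmod (u n) @[n --> \oo] --> sqmod l.
Proof. by move=> [hr hi]; apply: cvgD; rewrite !expr2; apply: cvgM. Qed.

Lemma energy_fatou (D : set R) (u : nat -> R -> R[i]) (g : R -> R[i]) (c : \bar R) :
  measurable D -> (forall n, cmeasurable D (u n)) ->
  (forall x, D x -> ccvg (u^~ x) (g x)) ->
  (forall n, energy D (u n) <= c) -> energy D g <= c.
Proof.
move=> mD mu_ ug uc.
have := @fatou _ _ _ mu D mD (fun n x => (sqmod (u n x))%:E).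
move=> /(_ (fun n => measurable_EFin_sqmod (mu_ n))).
move=> /(_ (fun n x _ => sqmod_ge0 (u n x))) h.
apply: le_trans (le_trans h (limn_einf_le uc)).
rewrite le_eqVlt; apply/orP; left; apply/eqP; apply: eq_integral => x /set_mem Dx.
have hc : (sqmod (u n x))%:E @[n --> \oo] --> (sqmod (g x))%:E.
  by apply: cvg_EFin; [exact: nearW|exact: sqmod_cvg (ug _ Dx)].
rewrite is_cvg_limn_einfE; last by apply/cvg_ex; eexists; exact: hc.
by apply/esym/cvg_lim.
Qed.

End PointwiseLimits.

(** * A compactness criterion *)

Section CompactnessCriterion.
Context {R : realType}.
Local Notation mu := (@lebesgue_measure R).
Variables (m : R -> R[i]) (H : (R -> R[i]) -> R -> R[i]) (w : R -> R) (C : R).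
Hypothesis mm : cmeasurable Rplus m.
Hypothesis w0 : forall x, 0 < x -> 0 <= w x.
Hypothesis cw : forall x, 0 < x -> {for x, continuous w}.
Hypothesis linH : forall (a : R[i]) f g, L2 f -> L2 g -> forall x, 0 < x ->
  H (fun x => a * f x + g x) x = a * H f x + H g x.
Hypothesis leH : forall f, L2 f -> forall x, 0 < x ->
  ((sqmod (H f x))%:E <= (2 * w x)%:E * energy Rplus f)%E.
Hypothesis modH : forall f, L2 f -> forall x y, 0 < x -> 0 < y ->
  ((sqmod (H f x - H f y))%:E <= (2 * `|w x - w y|)%:E * energy Rplus f)%E.
Hypothesis C0 : 0 <= C.
Hypothesis bndH : forall f, L2 f ->
  (energy Rplus (fun x => m x * H f x)%R <= C%:E * energy Rplus f)%E.
Hypothesis smallH : forall e : R, 0 < e -> exists a b : R, 0 < a /\ forall f, L2 f ->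
  (energy (Rplus `\` `[a, b]) (fun x => m x * H f x)%R <= e%:E * energy Rplus f)%E.
Hypothesis locH : forall a b : R, 0 < a ->
  (\int[mu]_(x in `[a, b]) (sqmod (m x) * w x)%:E < +oo)%E.

Let T f x := m x * H f x.

(** [H f] inherits continuity from [w] through [modH]. *)
Let continuous_H f : L2 f -> forall x, 0 < x ->
  {for x, continuous (fun y => complex.Re (H f y))} /\
  {for x, continuous (fun y => complex.Im (H f y))}.
Proof.
move=> Lf x x0; have /L2P[_ f2] := Lf.
set N := fine (energy Rplus f).
have EN : energy Rplus f = N%:E by rewrite fineK// ge0_fin_numE ?energy_ge0.
have N0 : 0 <= N by rewrite fine_ge0// energy_ge0.
have key (e : R) : 0 < e -> \forall y \near x, sqmod (H f x - H f y) <= e ^+ 2.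
  move=> e0; have d0 : 0 < e ^+ 2 / (2 * (N + 1)).
    by rewrite divr_gt0// ?exprn_gt0// mulr_gt0// ltr_wpDl.
  have /cvgrPdist_le/(_ _ d0)  := cw x0 => hw; near=> y.
  have y0 : 0 < y by near: y; exact: lt_nbhsr.
  rewrite -lee_fin; apply: le_trans (modH Lf x0 y0) _.
  rewrite EN -EFinM lee_fin.
  apply: (@le_trans _ _ (2 * (e ^+ 2 / (2 * (N + 1))) * (N + 1))); last first.
    by rewrite le_eqVlt; apply/orP; left; apply/eqP; field; rewrite gt_eqF// ltr_wpDl.
  apply: ler_pM => //; rewrite ?mulr_ge0// ?lerDl// ler_pM2l//.
  by near: y; exact: hw.
split; apply/cvgrPdist_le => e e0; apply: filterS (key e e0) => y hy;
  rewrite -ler_sqr ?nnegrE ?(ltW e0)// real_normK ?num_real//; apply: le_trans hy.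
- by rewrite -ReCN -ReCD; exact: sqr_Re_le.
- by rewrite -ImCN -ImCD; exact: sqr_Im_le.
Unshelve. all: by end_near. Qed.

Let measurable_H f : L2 f -> cmeasurable Rplus (H f).
Proof.
move=> Lf; split; apply: open_continuous_measurable_fun; try exact: interval_open;
  by move=> x /set_mem/in_Rplus x0; have [] := continuous_H Lf x0.
Qed.

Let measurable_T f : L2 f -> cmeasurable Rplus (T f).
Proof. by move=> Lf; apply: cmeasurableM => //; exact: measurable_H. Qed.

Let part (b : bool) (z : R[i]) : R := if b then complex.Re z else complex.Im z.

Let sqr_part b z : part b z ^+ 2 <= sqmod z.
Proof. by case: b; [exact: sqr_Re_le|exact: sqr_Im_le]. Qed.

Let partB b z z' : part b (z - z') = part b z - part b z'.
Proof. by case: b; rewrite /part ?ReCD ?ImCD ?ReCN ?ImCN. Qed.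

Let converging_subsequence (f : nat -> R -> R[i]) (M : R) : 0 < M ->
  (forall n, L2 (f n)) -> (forall n, (energy Rplus (f n) <= M%:E)%E) ->
  exists (k : nat -> nat) (G : R -> R[i]), {homo k : m n / (m < n)%N} /\
    forall x, 0 < x -> ccvg (fun n => H (f (k n)) x) (G x).
Proof.
move=> M0 Lf fM.
have M20 : 0 < 2 * M by rewrite mulr_gt0.
have M2n : 2 * M != 0 by rewrite gt_eqF.
have [|||k kinc kcv] := @equicontinuous_subsequence R
  (fun n b x => part b (H (f n) x)) (fun x => Num.sqrt (2 * w x * M))
  (fun x => 2 * M * w x).
- move=> n b x x0; rewrite -sqrtr_sqr ler_wsqrtr//.
  apply: le_trans (sqr_part _ _) _; rewrite -lee_fin.
  apply: le_trans (leH (Lf n) x0) _; rewrite [leRHS]EFinM.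
  by apply: lee_wpmul2l; rewrite ?fM// lee_fin mulr_ge0// w0.
- by move=> x x0; apply: cvgMr; exact: cw.
- move=> n b x y x0 y0; rewrite -partB.
  apply: le_trans (sqr_part _ _) _; rewrite -lee_fin.
  apply: le_trans (modH (Lf n) x0 y0) _.
  rewrite -mulrBr normrM (gtr0_norm M20) mulrAC [leRHS]EFinM.
  by apply: lee_wpmul2l; rewrite ?fM// lee_fin mulr_ge0.
have /choice[l hl] : forall bx : bool * R, exists l : R, 0 < bx.2 ->
    part bx.1 (H (f (k n)) bx.2) @[n --> \oo] --> l.
  move=> [b x]; have [x0|x0] := pselect (0 < x); last by exists 0.
  by have [l hl] := kcv b x x0; exists l.
exists k, (fun x => Complex (l (true, x)) (l (false, x))); split => // x x0.
by split; [exact: (hl (true, x))|exact: (hl (false, x))].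
Qed.

(** For an operator [f |-> m * H f] the bound [leH] and the modulus [modH] allow
    the extraction of a pointwise convergent subsequence; [locH] gives the
    dominating function on a compact interval, and [smallH], with Fatou for the
    limit, takes care of the complement. *)
Lemma energy_compact_criterion : energy_compact (fun f x => m x * H f x).
Proof.
split=> //.
- by move=> a f g Lf Lg x /in_Rplus x0; rewrite linH//; ring.
- by exists C.
move=> f M' Lf fM'.
pose M := `|M'| + 1.
have M0 : 0 < M by rewrite ltr_wpDl.
have fM n : (energy Rplus (f n) <= M%:E)%E.
  apply: le_trans (fM' n) _; rewrite lee_fin /M (le_trans (ler_norm _))//.
  by rewrite lerDl.
have [k [G [kinc GP]]] := converging_subsequence M0 Lf fM.
exists k; pose g x := m x * G x; exists g.
have gP (x : R) : 0 < x -> ccvg (fun n => T (f (k n)) x) (g x).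
  by move=> x0; apply: ccvgMr; exact: GP.
have mT n : cmeasurable Rplus (T (f (k n))) by exact: measurable_T.
have mg : cmeasurable Rplus g.
  split; [apply: (measurable_fun_cvg (fun n => (mT n).1))|
          apply: (measurable_fun_cvg (fun n => (mT n).2))];
    by move=> x /in_Rplus x0; have [] := gP _ x0.
have fatou_g (D : set R) (c : \bar R) : measurable D -> D `<=` Rplus ->
    (forall n, energy D (T (f (k n))) <= c)%E -> (energy D g <= c)%E.
  move=> mD DR; apply: energy_fatou => //.
  - by move=> n; exact: cmeasurableS measurable_Rplus DR (mT n).
  - by move=> x /DR/in_Rplus; exact: gP.
split => //.
  apply/L2P; split => //; apply: (@le_lt_trans _ _ (C%:E * M%:E)%E); last by rewrite ltey.
  apply: fatou_g => // [|n]; first exact: measurable_Rplus.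
  apply: le_trans (bndH _) _ => //.
  by apply: lee_wpmul2l; rewrite ?lee_fin.
apply/cvge0P => [n|e e0]; first exact: energy_ge0.
(* Outside [a, b] both terms have energy at most e / 8, hence their difference
   at most e / 2; the other half of e is left for the interval. *)
have e1 : 0 < e / (8 * M) by rewrite divr_gt0// mulr_gt0.
have [a [b [a0 outab]]] := smallH e1.
have abR : `[a, b] `<=` Rplus.
  by move=> x; rewrite /Rplus /= !in_itv /= andbT => /andP[ax _]; exact: lt_le_trans ax.
set O := Rplus `\` `[a, b].
have mO : measurable O by apply: measurableD => //; exact: measurable_Rplus.
have OR : O `<=` Rplus by move=> x [].
have outT n : (energy O (T (f (k n))) <= (e / 8)%:E)%E.
  apply: le_trans (outab _ (Lf _)) _.
  apply: (@le_trans _ _ ((e / (8 * M))%:E * M%:E)%E).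
    by apply: lee_wpmul2l; rewrite ?lee_fin ?(ltW e1).
  rewrite -EFinM lee_fin le_eqVlt; apply/orP; left; apply/eqP.
  by field; rewrite gt_eqF.
have outg : (energy O g <= (e / 8)%:E)%E by exact: fatou_g.
have inn : energy `[a, b] (fun x => T (f (k n)) x - g x) @[n --> \oo] --> 0%E.
  pose d x := (8 * M * (sqmod (m x) * w x))%:E.
  have mTg n : cmeasurable `[a, b] (fun x => T (f (k n)) x - g x).
    apply: cmeasurableS measurable_Rplus abR _.
    by apply: cmeasurableD => //; exact: cmeasurableN.
  have Hx n x : 0 < x -> sqmod (H (f (k n)) x) <= 2 * w x * M.
    move=> x0; rewrite -lee_fin; apply: le_trans (leH (Lf _) x0) _; rewrite [leRHS]EFinM.
    by apply: lee_wpmul2l; rewrite ?fM// lee_fin mulr_ge0// w0.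
  have Gx x : 0 < x -> sqmod (G x) <= 2 * w x * M.
    move=> x0; apply: cvgr_to_le (sqmod_cvg (GP _ x0)) _.
    by apply: nearW => n; exact: Hx.
  have := @dominated_convergence _ _ _ mu `[a, b] (measurable_itv _)
    (fun n x => (sqmod (T (f (k n)) x - g x))%:E) (cst 0%E) d.
  case.
  - by move=> n; exact: measurable_EFin_sqmod.
  - exact: measurable_cst.
  - apply: aeW => x /abR/in_Rplus x0.
    apply: cvg_EFin; first exact: nearW.
    by rewrite -(sqmod0 (R := R)); apply/sqmod_cvg/ccvg_sub0/gP.
  - rewrite (_ : d = fun x => (8 * M)%:E * (sqmod (m x) * w x)%:E)%E//.
    apply: integrableZl => //; apply/integrableP; split.
      apply/measurable_EFinP; apply: measurable_funS measurable_Rplus abR _.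
      apply: measurable_funM; first exact: measurable_sqmod.
      apply: open_continuous_measurable_fun; first exact: interval_open.
      by move=> x /set_mem/in_Rplus; exact: cw.
    have d0 x : x \in `[a, b] -> (0 <= (sqmod (m x) * w x)%:E)%E.
      by move=> /abR/in_Rplus x0; rewrite lee_fin mulr_ge0 ?sqmod_ge0 ?w0.
    apply: le_lt_trans (locH b a0).
    by apply: ge0_le_integral_subset => // x /d0 dx; rewrite gee0_abs.
  - apply: aeW => x n /abR/in_Rplus x0; rewrite gee0_abs ?lee_fin ?sqmod_ge0//.
    rewrite /T /g -mulrBr sqmodM.
    rewrite (_ : 8 * M * _ = sqmod (m x) * (2 * (2 * w x * M) + 2 * (2 * w x * M))); last by ring.
    apply: ler_wpM2l; first exact: sqmod_ge0.
    apply: le_trans (sqmodB_le _ _) _.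
    by apply: lerD; apply: ler_wpM2l => //; [exact: Hx|exact: Gx].
  by move=> _ _; rewrite integral_cst// mul0e.
have e2 : 0 < e / 2 by rewrite divr_gt0.
move/cvge0P : inn => /(_ (fun=> energy_ge0 _ _) _ e2); apply: filterS => n hn.
have -> : energy Rplus (fun x => m x * H (f (k n)) x - g x) =
    (energy `[a, b] (fun x => T (f (k n)) x - g x)%R +
     energy O (fun x => T (f (k n)) x - g x)%R)%E.
  have UE : `[a, b] `|` O = Rplus by rewrite setDUK.
  rewrite /energy -[in LHS]UE ge0_integral_setU//.
  - rewrite UE; apply: measurable_EFin_sqmod.
    by apply: cmeasurableD; [exact: mT|exact: cmeasurableN].
  - by move=> x _; rewrite lee_fin sqmod_ge0.
  - by apply/disj_set2P; rewrite setDIK.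
rewrite (splitr e) EFinD; apply: leeD => //.
apply: le_trans.
  apply: energyB_le => //; first exact: cmeasurableS measurable_Rplus OR (mT n).
  exact: cmeasurableS measurable_Rplus OR mg.
apply: (@le_trans _ _ (2%:E * (e / 8)%:E + 2%:E * (e / 8)%:E)%E).
  by apply: leeD; apply: lee_wpmul2l.
by rewrite -!EFinM -EFinD lee_fin le_eqVlt; apply/orP; left; apply/eqP; field.
Qed.

End CompactnessCriterion.

(** * Complex integrals over nested domains *)

Section ComplexIntegral.
Context {R : realType}.
Local Notation mu := (@lebesgue_measure R).
Implicit Types (D A B : set R) (u v f g kappa : R -> R[i]).

Definition cintegrable D u :=
  mu.-integrable D (EFin \o (fun x => complex.Re (u x))) /\
  mu.-integrable D (EFin \o (fun x => complex.Im (u x))).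

Lemma complex_ext (z z' : R[i]) : complex.Re z = complex.Re z' ->
  complex.Im z = complex.Im z' -> z = z'.
Proof. by case: z; case: z' => a b c d /= -> ->. Qed.

Lemma cintegralD D u v : measurable D -> cintegrable D u -> cintegrable D v ->
  cintegral D (fun x => u x + v x) = cintegral D u + cintegral D v.
Proof.
move=> mD [u1 u2] [v1 v2]; apply: complex_ext; rewrite ?ReCD ?ImCD /=.
- by under eq_Rintegral do rewrite ReCD; exact: RintegralD.
- by under eq_Rintegral do rewrite ImCD; exact: RintegralD.
Qed.

Lemma cintegralZ D (a : R[i]) u : measurable D -> cintegrable D u ->
  cintegral D (fun x => a * u x) = a * cintegral D u.
Proof.
move=> mD [u1 u2].
have i1 r : mu.-integrable D (EFin \o (fun x => r * complex.Re (u x))).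
  exact: (@integrableZl _ _ _ mu D mD r _ u1).
have i2 r : mu.-integrable D (EFin \o (fun x => r * complex.Im (u x))).
  exact: (@integrableZl _ _ _ mu D mD r _ u2).
apply: complex_ext; rewrite ?ReCM ?ImCM /=.
- under eq_Rintegral do rewrite ReCM.
  by rewrite RintegralB ?RintegralZl.
- under eq_Rintegral do rewrite ImCM.
  by rewrite RintegralD ?RintegralZl.
Qed.

Lemma cintegral_setU A B u : measurable A -> measurable B ->
  cintegrable (A `|` B) u -> A `&` B = set0 ->
  cintegral (A `|` B) u = cintegral A u + cintegral B u.
Proof.
move=> mA mB [u1 u2] AB; apply: complex_ext; rewrite ?ReCD ?ImCD /=;
  by rewrite Rintegral_setU//; exact/disj_set2P.
Qed.

Lemma eq_cintegral D u v : {in D, u =1 v} -> cintegral D u = cintegral D v.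
Proof.
by move=> uv; apply: complex_ext => /=; apply: eq_Rintegral => x xD; rewrite uv.
Qed.

Lemma cintegrable_mul D kappa f : measurable D -> D `<=` Rplus ->
  cmeasurable D kappa -> (energy D kappa < +oo)%E -> L2 f ->
  cintegrable D (fun y => kappa y * f y).
Proof.
move=> mD DR mk koo /L2P[mf f2].
have mfD := cmeasurableS measurable_Rplus DR mf.
have [m1 m2] := cmeasurableM mk mfD.
have foo : (energy D f < +oo)%E.
  apply: le_lt_trans f2.
  by apply: ge0_le_integral_subset => // x _; rewrite lee_fin sqmod_ge0.
split; apply: (@integrable_sqr_le _ _ _ (fun x => sqmod (kappa x)) (fun x => sqmod (f x))) => //;
  try (by move=> x _; exact: sqmod_ge0); try exact: measurable_sqmod.
- by move=> x _; rewrite -sqmodM sqr_Re_le.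
- by move=> x _; rewrite -sqmodM sqr_Im_le.
Qed.

Lemma sqmod_cintegral_mul_le D kappa f : measurable D -> D `<=` Rplus ->
  cmeasurable D kappa -> L2 f ->
  ((sqmod (cintegral D (fun y => kappa y * f y)))%:E <=
   2%:E * (energy D kappa * energy Rplus f))%E.
Proof.
move=> mD DR mk /L2P[mf f2].
have mfD := cmeasurableS measurable_Rplus DR mf.
apply: le_trans.
  apply: (@sqmod_cintegral_le _ _ _ (fun x => sqmod (kappa x)) (fun x => sqmod (f x))) => //.
  - exact: cmeasurableM.
  - exact: measurable_sqmod.
  - exact: measurable_sqmod.
  - by move=> x _; exact: sqmod_ge0.
  - by move=> x _; exact: sqmod_ge0.
  - by move=> x _; rewrite sqmodM.
apply: lee_wpmul2l => //; apply: lee_wpmul2l; first exact: energy_ge0.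
by apply: ge0_le_integral_subset => // x _; rewrite lee_fin sqmod_ge0.
Qed.

(** The difference is the integral over [B] minus [A]; its squared modulus is
    controlled by the energy of [kappa] there, which is a difference of energies.
    This is the source of equicontinuity. *)
Lemma sqmod_cintegral_sub_le A B kappa f : measurable A -> measurable B ->
  A `<=` B -> B `<=` Rplus -> cmeasurable B kappa -> (energy B kappa < +oo)%E -> L2 f ->
  ((sqmod (cintegral B (fun y => kappa y * f y) -
           cintegral A (fun y => kappa y * f y)))%:E <=
   (2 * (fine (energy B kappa) - fine (energy A kappa)))%:E * energy Rplus f)%E.
Proof.
move=> mA mB AB BR mk koo Lf.
have mBA : measurable (B `\` A) by exact: measurableD.
have BE : B = A `|` (B `\` A) by rewrite setDUK.
have dAB : A `&` (B `\` A) = set0 by rewrite setDIK.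
have s0 (x : R) : (0 <= (sqmod (kappa x))%:E)%E by rewrite lee_fin sqmod_ge0.
have Ek : energy B kappa = (energy A kappa + energy (B `\` A) kappa)%E.
  rewrite /energy [in LHS]BE ge0_integral_setU//.
  - by rewrite -BE; exact: measurable_EFin_sqmod.
  - exact/disj_set2P.
have Aoo : (energy A kappa < +oo)%E.
  by apply: le_lt_trans koo; exact: ge0_le_integral_subset.
have BAoo : (energy (B `\` A) kappa < +oo)%E.
  by apply: le_lt_trans koo; apply: ge0_le_integral_subset => // x [].
rewrite (_ : _ - _ = cintegral (B `\` A) (fun y => kappa y * f y)); last first.
  rewrite [in X in X - _]BE cintegral_setU//; first by rewrite addrC addrA addNr add0r.
  by rewrite -BE; exact: cintegrable_mul.
apply: le_trans.
  apply: sqmod_cintegral_mul_le => //; first by move=> x [/BR].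
  by apply: cmeasurableS mk => // x [].
rewrite muleA EFinM Ek fineD ?ge0_fin_numE ?energy_ge0// addrAC subrr add0r.
by rewrite fineK// ge0_fin_numE ?energy_ge0.
Qed.

End ComplexIntegral.

Section NestedDomains.
Context {R : realType}.
Local Notation mu := (@lebesgue_measure R).
Variables (kappa : R -> R[i]) (E : R -> set R).
Hypothesis mkappa : cmeasurable Rplus kappa.
Hypothesis mE : forall x, measurable (E x).
Hypothesis ER : forall x, 0 < x -> E x `<=` Rplus.
Hypothesis Eoo : forall x, 0 < x -> (energy (E x) kappa < +oo)%E.
Hypothesis nested : forall x y, 0 < x -> 0 < y -> E x `<=` E y \/ E y `<=` E x.

Let mkE x : 0 < x -> cmeasurable (E x) kappa.
Proof. by move=> x0; exact: cmeasurableS measurable_Rplus (ER x0) mkappa. Qed.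

Let ikE x f : 0 < x -> L2 f -> cintegrable (E x) (fun y => kappa y * f y).
Proof. by move=> x0 Lf; apply: cintegrable_mul => //; [exact: ER|exact: mkE|exact: Eoo]. Qed.

Lemma nested_linear (a : R[i]) f g : L2 f -> L2 g -> forall x, 0 < x ->
  cintegral (E x) (fun y => kappa y * (a * f y + g y)) =
  a * cintegral (E x) (fun y => kappa y * f y) + cintegral (E x) (fun y => kappa y * g y).
Proof.
move=> Lf Lg x x0.
rewrite -cintegralZ//; last exact: ikE.
have Laf : L2 (fun y => a * f y).
  have L0 : L2 (fun=> 0 : R[i]).
    apply/L2P; split; first exact: cmeasurable_cst.
    by rewrite /energy integral0_eq// => y _; rewrite sqmod0.
  by have := L2_linear a Lf L0; congr L2; apply/funext => y; rewrite addr0.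
rewrite -cintegralD//; last 2 first.
- have := ikE x0 Laf; congr (cintegrable _ _).
  by apply/funext => y; ring.
- exact: ikE.
by apply: eq_cintegral => y _; ring.
Qed.

Lemma nested_le f : L2 f -> forall x, 0 < x ->
  ((sqmod (cintegral (E x) (fun y => kappa y * f y)))%:E <=
   (2 * fine (energy (E x) kappa))%:E * energy Rplus f)%E.
Proof.
move=> Lf x x0; rewrite EFinM fineK ?ge0_fin_numE ?energy_ge0 ?Eoo// -muleA.
by apply: sqmod_cintegral_mul_le => //; [exact: ER|exact: mkE].
Qed.

Lemma nested_modulus f : L2 f -> forall x y, 0 < x -> 0 < y ->
  ((sqmod (cintegral (E x) (fun z => kappa z * f z) -
           cintegral (E y) (fun z => kappa z * f z)))%:E <=
   (2 * `|fine (energy (E x) kappa) - fine (energy (E y) kappa)|)%:E * energy Rplus f)%E.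
Proof.
move=> Lf.
have key x y : 0 < x -> 0 < y -> E x `<=` E y ->
  ((sqmod (cintegral (E x) (fun z => kappa z * f z) -
           cintegral (E y) (fun z => kappa z * f z)))%:E <=
   (2 * `|fine (energy (E x) kappa) - fine (energy (E y) kappa)|)%:E * energy Rplus f)%E.
  move=> x0 y0 xy; rewrite -sqmodN opprB.
  apply: le_trans.
    by apply: sqmod_cintegral_sub_le => //; [exact: ER|exact: mkE|exact: Eoo].
  apply: lee_wpmul2r; first exact: energy_ge0.
  by rewrite lee_fin ler_pM2l// distrC ler_norm.
move=> x y x0 y0; have [xy|yx] := nested x0 y0; first exact: key.
by rewrite -sqmodN opprB distrC; exact: key.
Qed.

End NestedDomains.

(** * Consequences of the dyadic conditions *)

Section DyadicBounds.
Context {R : realType}.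
Local Notation mu := (@lebesgue_measure R).
Variable phi : R -> R[i].
Hypothesis mphi : cmeasurable Rplus phi.

Let p x := sqmod (phi x).

Let mp : measurable_fun Rplus p. Proof. exact: measurable_sqmod. Qed.
Let p0 (x : R) : Rplus x -> 0 <= p x. Proof. by move=> _; exact: sqmod_ge0. Qed.

(** The weighted tail at [a] dominates [sqrt a] times the plain tail. *)
Lemma energy_tail_le (D a : R) : 0 <= D -> dyadic_bound p D -> 0 < a ->
  (energy `[a, +oo[ phi <= (12 * D / a)%:E)%E.
Proof.
move=> D0 pD a0; have sa0 : 0 < Num.sqrt a by rewrite sqrtr_gt0.
have asq : a = Num.sqrt a ^+ 2 by rewrite sqr_sqrtr ?ltW.
have sub := itvcy_sub_Rplus a0.
have h : ((Num.sqrt a)%:E * energy `[a, +oo[ phi <= (12 * D / Num.sqrt a)%:E)%E.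
  apply: le_trans (sqrt_tail_le p0 mp D0 pD a0).
  rewrite -ge0_integralZl_EFin ?sqrtr_ge0//; last 2 first.
  - by move=> x _; rewrite lee_fin sqmod_ge0.
  - by apply: measurable_EFin_sqmod; exact: cmeasurableS measurable_Rplus sub mphi.
  rewrite /sqrt_tail; apply: ge0_le_integral_subset => //.
  - by move=> x _; rewrite -EFinM lee_fin mulr_ge0// sqmod_ge0.
  - by move=> x _; rewrite lee_fin mulr_ge0// sqmod_ge0.
  - move=> x; rewrite /= in_itv /= andbT => ax; rewrite -EFinM lee_fin.
    by apply: ler_wpM2r; [exact: sqmod_ge0|exact: ler_wsqrtr].
rewrite -(@lee_pmul2l _ (Num.sqrt a)%:E) ?lte_fin//.
apply: le_trans h _; rewrite -EFinM lee_fin le_eqVlt; apply/orP; left; apply/eqP.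
by rewrite [X in _ * (_ / X)]asq; field; rewrite gt_eqF.
Qed.

Definition outer (N : nat) : set R := Rplus `\` `[2 ^ (- N%:Z), 2 ^ N%:Z].

Lemma measurable_outer N : measurable (outer N).
Proof. by apply: measurableD; [exact: measurable_Rplus|exact: measurable_itv]. Qed.

Definition crestrict (A : set R) (x : R) : R[i] := if x \in A then phi x else 0.

Lemma sqmod_crestrict_le (A : set R) x : sqmod (crestrict A x) <= p x.
Proof. by rewrite /crestrict; case: ifPn => // _; rewrite sqmod0 sqmod_ge0. Qed.

Lemma cmeasurable_crestrict (A : set R) : measurable A -> cmeasurable Rplus (crestrict A).
Proof.
have part (c : R[i] -> R) : c 0 = 0 -> measurable A -> measurable_fun Rplus (c \o phi) ->
    measurable_fun Rplus (fun x => c (crestrict A x)).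
  move=> c0 mA mc.
  rewrite (_ : (fun x => _) = (c \o phi) \_ A).
    apply/(measurable_restrict _ mA measurable_Rplus).
    by apply: measurable_funS mc => //; exact: measurable_Rplus.
  by apply/funext => x; rewrite /crestrict patchE; case: ifPn.
by move=> mA; have [m1 m2] := mphi; split; exact: part.
Qed.

Lemma dyadicE (n : int) : dyadic phi n =
  ((2 ^ n)%:E * \int[mu]_(x in `[(2:R) ^ n, 2 ^ (n + 1)]) (p x)%:E)%E.
Proof.
by congr (_ * _)%E; apply: eq_integral => x _; rewrite cmod_sq.
Qed.

Lemma Xinfty_dyadic_bound : Xinfty phi -> exists2 D : R, 0 <= D & dyadic_bound p D.
Proof.
move=> [_]; set S := ereal_sup _ => Soo.
have dS n : (dyadic phi n <= S)%E by apply: ereal_sup_ubound; exists n.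
have S0 : (0 <= S)%E.
  apply: le_trans (dS 0); rewrite dyadicE; apply: mule_ge0.
    by rewrite lee_fin ltW// exp2z_gt0.
  by apply: integral_ge0 => x _; rewrite lee_fin sqmod_ge0.
exists (fine S); first exact: fine_ge0.
by move=> n; rewrite -dyadicE fineK// ge0_fin_numE.
Qed.

(** Decay at both ends means that setting [phi] to 0 on [2^-N, 2^N] makes all its
    dyadic quantities small: the blocks with [-N < n < N] lie inside the removed
    interval, the other ones are small already. *)
Lemma X0infty_outer_bound (e : R) : X0infty phi -> 0 < e ->
  exists N, dyadic_bound (fun x => sqmod (crestrict (outer N) x)) e.
Proof.
have d0 n : (0 <= dyadic phi n)%E.
  rewrite dyadicE; apply: mule_ge0.
    by rewrite lee_fin ltW// exp2z_gt0.
  by apply: integral_ge0 => x _; rewrite lee_fin sqmod_ge0.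
move=> [_ /cvge0P hp /cvge0P hm] e0.
have [N1 _ h1] := hp (fun=> d0 _) _ e0.
have [N2 _ h2] := hm (fun=> d0 _) _ e0.
pose N := maxn N1 N2; exists N => n.
have near_case : (dyadic phi n <= e%:E)%E ->
    ((2 ^ n)%:E * \int[mu]_(x in `[2 ^ n, 2 ^ (n + 1)])
       (sqmod (crestrict (outer N) x))%:E <= e%:E)%E.
  move=> h; apply: le_trans h; rewrite dyadicE; apply: lee_wpmul2l.
    by rewrite lee_fin ltW// exp2z_gt0.
  apply: ge0_le_integral_subset => // x _; rewrite lee_fin ?sqmod_ge0//.
  exact: sqmod_crestrict_le.
have [nN|nN] := leP (N%:Z) n.
  apply: near_case; have -> : n = `|n|%N%:Z.
    by rewrite abszE ger0_norm// (le_trans _ nN).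
  apply: h1 => /=; rewrite -lez_nat abszE ger0_norm; last exact: le_trans nN.
  by apply: le_trans nN; rewrite lez_nat leq_maxl.
have [nN'|nN'] := leP n (- N%:Z).
  apply: near_case; have -> : n = - `|n|%N%:Z.
    by rewrite abszE ler0_norm ?opprK// (le_trans nN')// oppr_le0.
  apply: h2 => /=; rewrite -lez_nat abszE ler0_norm; last by rewrite (le_trans nN')// oppr_le0.
  by rewrite lerNr; apply: (le_trans nN'); rewrite lerN2 lez_nat leq_maxr.
rewrite integral0_eq; first by rewrite mule0 lee_fin ltW.
move=> x /=; rewrite in_itv /= => /andP[nx xn].
rewrite /crestrict memNset ?sqmod0// => -[_]; apply => /=; rewrite in_itv /=.
apply/andP; split.
  by apply: le_trans nx; rewrite ler_eXz2l ?ltr1n// ltW.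
by apply: le_trans xn _; rewrite ler_eXz2l ?ltr1n// lezD1.
Qed.

End DyadicBounds.

(** * Compactness under the dyadic decay condition *)

Section CompactOperators.
Context {R : realType}.
Local Notation mu := (@lebesgue_measure R).
Variable phi : R -> R[i].
Hypothesis mphi : cmeasurable Rplus phi.
Hypothesis X0phi : X0infty phi.

Let mRp : measurable (Rplus : set R). Proof. exact: measurable_Rplus. Qed.

Lemma energy_cst1_itv (x : R) : 0 < x -> energy `]0, x[ (fun=> 1 : R[i]) = x%:E.
Proof.
move=> x0; rewrite /energy (_ : (fun _ => _) = cst 1%:E).
  by rewrite integral_cst//= lebesgue_measure_itv /= lte_fin x0 oppr0 adde0 mul1e.
by apply/funext => y; rewrite /sqmod /= expr1n expr0n addr0.
Qed.

(** The criterion with [m = phi], [H f = F] and [w x = x], the length of ]0, x[.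
    Far away, [phi] may be replaced by its truncation, whose dyadic bound, and
    thus whose operator norm, is small. *)
Lemma energy_compact_lower : energy_compact (fun f x => phi x * lower_int f x).
Proof.
have [Xphi _ _] := X0phi; have [D D0 phiD] := Xinfty_dyadic_bound Xphi.
have lowerE f x : lower_int f x = cintegral `]0, x[ (fun y => 1 * f y).
  by apply: eq_cintegral => y _; rewrite mul1r.
have m1 : cmeasurable Rplus (fun=> 1 : R[i]) by exact: cmeasurable_cst.
have ER (x : R) : 0 < x -> `]0, x[ `<=` Rplus by move=> _; exact: itv0oo_sub_Rplus.
have Eoo (x : R) : 0 < x -> (energy `]0%R, x[ (fun=> 1%R : R[i]) < +oo)%E.
  by move=> x0; rewrite energy_cst1_itv// ltey.
have nested (x y : R) : 0 < x -> 0 < y -> (`]0, x[ `<=` `]0, y[) \/ (`]0, y[ `<=` `]0, x[).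
  by move=> _ _; have [xy|yx] := leP x y; [left|right]; apply: subset_itvl; rewrite bnd_simp // ltW.
have mE (x : R) : measurable `]0, x[ by exact: measurable_itv.
apply: (@energy_compact_criterion R phi lower_int id (96 * D)) => //.
- by move=> x /ltW.
- by move=> x _; exact: cvg_id.
- by move=> a f g Lf Lg x x0; rewrite !lowerE; exact: (nested_linear m1 mE).
- move=> f Lf x x0; rewrite lowerE.
  by have := nested_le m1 mE ER Eoo Lf x0; rewrite energy_cst1_itv.
- move=> f Lf x y x0 y0; rewrite !lowerE.
  by have := nested_modulus m1 mE ER Eoo nested Lf x0 y0; rewrite !energy_cst1_itv.
- by rewrite mulr_ge0.
- by move=> f /L2P[mf _]; exact: hardy_lower.
- move=> e e0.
  have e96 : 0 < e / 96 by rewrite divr_gt0.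
  have [N hN] := X0infty_outer_bound X0phi e96.
  exists (2 ^ (- N%:Z)), (2 ^ N%:Z); split; first exact: exp2z_gt0.
  move=> f /L2P[mf _].
  have h := hardy_lower (cmeasurable_crestrict mphi (measurable_outer N)) mf _ hN.
  rewrite (_ : e = 96 * (e / 96)); last by field.
  apply: le_trans (h _); last by rewrite divr_ge0// ltW.
  apply: ge0_le_integral_subset => //.
  + by move=> x _; rewrite lee_fin sqmod_ge0.
  + by move=> x _; rewrite lee_fin sqmod_ge0.
  + by move=> x Ox; rewrite /crestrict mem_set.
- move=> a b a0.
  apply: (@le_lt_trans _ _ (`|b|%:E * energy `[a, +oo[ phi)%E); last first.
    apply: lte_mul_pinfty; rewrite ?lee_fin//.
    by apply: le_lt_trans (energy_tail_le mphi D0 phiD a0) _; rewrite ltey.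
  have sub := itvcy_sub_Rplus a0.
  rewrite -ge0_integralZl_EFin//; last 2 first.
  + by move=> x _; rewrite lee_fin sqmod_ge0.
  + by apply: measurable_EFin_sqmod; exact: cmeasurableS mRp sub mphi.
  apply: ge0_le_integral_subset.
  + by apply: subset_itvl.
  + move=> x; rewrite /= in_itv /= => /andP[ax _].
    by rewrite lee_fin mulr_ge0 ?sqmod_ge0// (le_trans (ltW a0)).
  + by move=> x _; rewrite -EFinM lee_fin mulr_ge0 ?sqmod_ge0.
  + move=> x; rewrite /= in_itv /= => /andP[ax xb].
    rewrite -EFinM lee_fin mulrC; apply: ler_wpM2r; first exact: sqmod_ge0.
    exact: le_trans (ler_norm _).
Qed.

(** Absolute continuity of the integral of [|phi|^2] away from 0. *)
Lemma tail_energy_continuous : forall x : R, 0 < x ->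
  {for x, continuous (fun y => fine (energy `[y, +oo[ phi))}.
Proof.
have [Xphi _ _] := X0phi; have [D D0 phiD] := Xinfty_dyadic_bound Xphi.
move=> x x0; pose a := x / 2; have a0 : 0 < a by rewrite divr_gt0.
have sub := itvcy_sub_Rplus a0.
have tailoo (y : R) : 0 < y -> (energy `[y, +oo[ phi < +oo)%E.
  by move=> y0; apply: le_lt_trans (energy_tail_le mphi D0 phiD y0) _; rewrite ltey.
pose q := (fun y => sqmod (phi y)) \_ `[a, +oo[.
have iq : mu.-integrable setT (EFin \o q).
  rewrite /q -restrict_EFin; apply/integrable_restrict => //=; rewrite setTI.
  apply/integrableP; split.
    by apply: measurable_EFin_sqmod; exact: cmeasurableS mRp sub mphi.
  apply: le_lt_trans (tailoo _ a0); apply: ge0_le_integral_subset => //.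
  + by move=> y _; rewrite lee_fin sqmod_ge0.
  + by move=> y _; rewrite gee0_abs// lee_fin sqmod_ge0.
apply/cvgrPdist_le => e e0.
have [d [d0 hd]] := integral_normr_continuous iq e0.
have key (u v : R) : a <= u -> u <= v -> v - u < d ->
    `|fine (energy `[u, +oo[ phi) - fine (energy `[v, +oo[ phi)| <= e.
  move=> au uv uvd; have u0 : 0 < u by exact: lt_le_trans au.
  have v0 : 0 < v by exact: lt_le_trans uv.
  have uE : `[u, +oo[%classic = `[u, v[ `|` `[v, +oo[.
    by rewrite -itv_bndbnd_setU// bnd_simp.
  have subu := itvcy_sub_Rplus u0.
  have ioo : (energy `[u, v[ phi < +oo)%E.
    apply: le_lt_trans (tailoo _ u0); apply: ge0_le_integral_subset => //.
    - by apply: subset_itvl.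
    - by move=> y _; rewrite lee_fin sqmod_ge0.
    - by move=> y _; rewrite lee_fin sqmod_ge0.
  have -> : energy `[u, +oo[ phi = (energy `[u, v[ phi + energy `[v, +oo[ phi)%E.
    rewrite /energy uE ge0_integral_setU//.
    - by rewrite -uE; apply: measurable_EFin_sqmod; exact: cmeasurableS mRp subu mphi.
    - by move=> y _; rewrite lee_fin sqmod_ge0.
    - apply/disj_set2P; rewrite -subset0 => y /=; rewrite !in_itv /= andbT.
      by move=> [/andP[_ /lt_le_trans h] /h]; rewrite ltxx.
  rewrite fineD ?ge0_fin_numE ?energy_ge0 ?tailoo// addrK ger0_norm ?fine_ge0 ?energy_ge0//.
  have muv : (mu `[u, v[ < d%:E)%E.
    by rewrite lebesgue_measure_itv /=; case: ifPn; rewrite ?lte_fin// -EFinB lte_fin.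
  have := hd _ (measurable_itv _) muv; rewrite /Rintegral => /ltW; apply: le_trans.
  rewrite le_eqVlt; apply/orP; left; apply/eqP; congr fine.
  apply: eq_integral => y /set_mem; rewrite /= in_itv /= => /andP[uy _].
  rewrite /q patchE mem_set ?ger0_norm ?sqmod_ge0//.
  by rewrite /= in_itv /= andbT (le_trans au).
near=> y.
have ay : a <= y.
  apply: ltW; near: y; apply: lt_nbhsr.
  by rewrite /a ltr_pdivrMr// ltr_pMr// ltr1n.
have xyd : `|x - y| < d by near: y; exact: cvgr_dist_lt.
have ax : a <= x by rewrite /a ler_pdivrMr// ler_pMr// ler1n.
have [xy|yx] := leP x y.
  by apply: key => //; apply: le_lt_trans xyd; rewrite distrC ler_norm.
rewrite distrC; apply: key => //; first exact: ltW.
by apply: le_lt_trans xyd; exact: ler_norm.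
Unshelve. all: by end_near. Qed.

(** Near 0 the tail of [|phi|^2] still sees the bulk of [phi], so it is not small
    in itself; the bulk contributes a constant (the second term), which becomes
    negligible against [1 / sqrt x] as [x] tends to 0. *)
Lemma sqrt_tail_crestrict_le (N : nat) (D e x : R) :
  0 <= D -> dyadic_bound (fun y => sqmod (phi y)) D ->
  0 <= e -> dyadic_bound (fun y => sqmod (crestrict phi (outer N) y)) e -> 0 < x ->
  (sqrt_tail (fun y => sqmod (phi y)) x <=
   (12 * e / Num.sqrt x + 12 * D / Num.sqrt (2 ^ (- N%:Z)))%:E)%E.
Proof.
move=> D0 phiD e0 Ne x0.
have mp := measurable_sqmod mphi.
have mr := measurable_sqmod (cmeasurable_crestrict mphi (measurable_outer N)).
have t0 := @exp2z_gt0 R (- N%:Z).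
have msqrt := @measurable_sqrt R Rplus.
set q := fun y => Num.sqrt y * sqmod (phi y).
have q0 y : 0 <= q y by rewrite mulr_ge0// sqmod_ge0.
have mq : measurable_fun Rplus q by exact: measurable_funM.
have sub := itvcy_sub_Rplus x0.
pose J : set R := `[2 ^ (- N%:Z), +oo[%classic.
have mJ : measurable J by exact: measurable_itv.
have JR : J `<=` Rplus by exact: itvcy_sub_Rplus.
rewrite EFinD; apply: le_trans; last first.
  apply: leeD; first exact: (sqrt_tail_le (fun x _ => sqmod_ge0 _) mr e0 Ne x0).
  exact: (sqrt_tail_le (fun x _ => sqmod_ge0 _) mp D0 phiD t0).
rewrite /sqrt_tail -/J.
have -> : (\int[mu]_(y in J) (Num.sqrt y * sqmod (phi y))%:E =
    \int[mu]_(y in Rplus) ((q \_ J) y)%:E)%E.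
  rewrite integral_mkcond [RHS]integral_mkcond; apply: eq_integral => y _.
  rewrite !patchE; case: ifPn => yJ; last by case: ifPn.
  by rewrite mem_set//; apply/JR/set_mem.
apply: (@le_trans _ _ (\int[mu]_(y in `[x, +oo[)
    ((Num.sqrt y * sqmod (crestrict phi (outer N) y))%:E + ((q \_ J) y)%:E))%E).
  apply: ge0_le_integral_subset => //.
  - by move=> y _; rewrite lee_fin; exact: q0.
  - move=> y _; apply: adde_ge0; rewrite lee_fin; first by rewrite mulr_ge0// sqmod_ge0.
    by rewrite patchE; case: ifPn.
  move=> y /sub Ry; rewrite -EFinD lee_fin patchE /crestrict; case: ifPn => yO.
    by rewrite lerDl; case: ifPn => // _; exact: q0.
  rewrite sqmod0 mulr0 add0r ifT//; apply/mem_set; rewrite /J /= in_itv /= andbT.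
  rewrite leNgt; apply/negP => yN; move/negP: yO; apply; apply/mem_set; split=> //=.
  by rewrite in_itv /= leNgt yN.
have mqJ : measurable_fun Rplus (q \_ J).
  apply/(measurable_restrict _ mJ measurable_Rplus).
  by apply: measurable_funS mq => //.
rewrite ge0_integralD//.
- apply: leeD => //; apply: ge0_le_integral_subset => //.
  + by move=> y _; rewrite lee_fin patchE; case: ifPn.
  + by move=> y _; rewrite lee_fin patchE; case: ifPn.
- by move=> y _; rewrite lee_fin mulr_ge0// sqmod_ge0.
- apply/measurable_EFinP; apply: measurable_funS mRp sub _.
  exact: measurable_funM.
- by move=> y _; rewrite lee_fin patchE; case: ifPn.
- by apply/measurable_EFinP; exact: measurable_funS mRp sub mqJ.
Qed.

Lemma sqrt_tail_far_le (N : nat) (e x : R) :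
  0 <= e -> dyadic_bound (fun y => sqmod (crestrict phi (outer N) y)) e -> 2 ^ N%:Z < x ->
  (sqrt_tail (fun y => sqmod (phi y)) x <= (12 * e / Num.sqrt x)%:E)%E.
Proof.
move=> e0 Ne Nx; have x0 : 0 < x by exact: lt_trans (exp2z_gt0 _) Nx.
have mr := measurable_sqmod (cmeasurable_crestrict mphi (measurable_outer N)).
apply: le_trans (sqrt_tail_le (fun x _ => sqmod_ge0 _) mr e0 Ne x0).
rewrite le_eqVlt; apply/orP; left; apply/eqP; apply: eq_integral => y /set_mem.
rewrite /= in_itv /= andbT => xy.
rewrite /crestrict mem_set//; split; first by apply/in_Rplus; exact: lt_le_trans xy.
by rewrite /= in_itv /= => /andP[_]; rewrite leNgt (lt_le_trans Nx xy).
Qed.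

(** The criterion with [m = 1], [H f = G] and [w x] the integral of [|phi|^2] over
    [x, oo[. *)
Lemma energy_compact_upper : energy_compact (upper_int phi).
Proof.
have [Xphi _ _] := X0phi; have [D D0 phiD] := Xinfty_dyadic_bound Xphi.
have ER (x : R) : 0 < x -> `[x, +oo[ `<=` Rplus by exact: itvcy_sub_Rplus.
have Eoo (x : R) : 0 < x -> (energy `[x, +oo[ phi < +oo)%E.
  by move=> x0; apply: le_lt_trans (energy_tail_le mphi D0 phiD x0) _; rewrite ltey.
have nested (x y : R) : 0 < x -> 0 < y -> (`[x, +oo[ `<=` `[y, +oo[) \/ (`[y, +oo[ `<=` `[x, +oo[).
  by move=> _ _; have [xy|yx] := leP x y; [right|left]; apply: subset_itvr; rewrite bnd_simp // ltW.
have mE (x : R) : measurable `[x, +oo[ by exact: measurable_itv.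
have m1 : cmeasurable Rplus (fun=> 1 : R[i]) by exact: cmeasurable_cst.
pose w (x : R) := fine (energy `[x, +oo[ phi).
have w0 x : 0 <= w x by rewrite fine_ge0// energy_ge0.
have one f : (fun x => 1 * upper_int phi f x) = upper_int phi f.
  by apply/funext => x; rewrite mul1r.
suff : energy_compact (fun f x => 1 * upper_int phi f x).
  by rewrite (_ : (fun f x => _) = upper_int phi)//; apply/funext => f; rewrite one.
apply: (@energy_compact_criterion R (fun=> 1) (upper_int phi) w (8 * (12 * D))) => //.
- exact: tail_energy_continuous.
- by move=> a f g Lf Lg x x0; exact: (nested_linear mphi mE).
- by move=> f Lf x x0; exact: (nested_le mphi mE ER Eoo Lf x0).
- by move=> f Lf x y x0 y0; exact: (nested_modulus mphi mE ER Eoo nested Lf x0 y0).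
- by rewrite !mulr_ge0.
- move=> f /L2P[mf _]; rewrite one; apply: hardy_upper => //; first by rewrite mulr_ge0.
  move=> x /in_Rplus x0; apply: sqrt_tail_le => //; last exact: measurable_sqmod.
  by move=> y _; exact: sqmod_ge0.
(* [192 = 8 * 24]: factor 8 from [hardy_upper], and 24 = 12 + 12 for the
   truncated part and the bulk.  The left end [r ^+ 2] is where the bulk constant
   [K] falls below [12 * d / sqrt x]. *)
- move=> e e0; pose d := e / 192.
  have d0 : 0 < d by rewrite divr_gt0.
  have [N hN] := X0infty_outer_bound X0phi d0.
  pose K := 12 * D / Num.sqrt (2 ^ (- N%:Z)).
  have K0 : 0 <= K by rewrite divr_ge0// mulr_ge0.
  pose r := 12 * d / (K + 1).
  have K1 : 0 < K + 1 by rewrite ltr_wpDl.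
  have r0 : 0 < r by rewrite divr_gt0// mulr_gt0.
  exists (r ^+ 2), (2 ^ N%:Z); split; first by rewrite exprn_gt0.
  move=> f /L2P[mf _]; rewrite one (_ : e = 8 * (24 * d)); last by rewrite /d; field.
  apply: hardy_upper => //; first by rewrite mulr_ge0// ltW.
  move=> x [/in_Rplus x0]; rewrite /= in_itv /= => /negP; rewrite negb_and -!ltNge => xO.
  have sx0 : 0 < Num.sqrt x by rewrite sqrtr_gt0.
  have [Nx|xN] := ltP (2 ^ N%:Z) x.
    apply: le_trans (sqrt_tail_far_le (ltW d0) hN Nx) _; rewrite lee_fin.
    apply: ler_wpM2r; first by rewrite invr_ge0 ltW.
    by apply: ler_wpM2r; rewrite ?(ltW d0)// ler_nat.
  have xr : x < r ^+ 2 by case/orP: xO => //; rewrite ltNge xN.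
  apply: le_trans (sqrt_tail_crestrict_le D0 phiD (ltW d0) hN x0) _.
  rewrite lee_fin -/K (_ : 24 * d / _ = 12 * d / Num.sqrt x + 12 * d / Num.sqrt x); last by ring.
  apply: lerD => //; rewrite ler_pdivlMr//.
  have xr' : Num.sqrt x <= r.
    by rewrite -(ger0_norm (ltW r0)) -sqrtr_sqr; apply/ler_wsqrtr/ltW.
  apply: (@le_trans _ _ ((K + 1) * r)); last by rewrite /r mulrC divfK// gt_eqF.
  by apply: ler_pM => //; rewrite ?lerDl.
- move=> a b a0.
  apply: (@le_lt_trans _ _ ((w a)%:E * mu `[a, b])%E).
    rewrite -integral_cst//; apply: ge0_le_integral_subset => //.
    + by move=> x _; rewrite lee_fin mulr_ge0// sqmod_ge0.
    + by move=> x _; rewrite lee_fin.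
    move=> x; rewrite /= in_itv /= => /andP[ax _]; rewrite lee_fin.
    rewrite (_ : sqmod 1 = 1) ?mul1r; last by rewrite /sqmod /= expr1n expr0n addr0.
    apply: fine_le; rewrite ?ge0_fin_numE ?energy_ge0 ?Eoo//; first exact: lt_le_trans ax.
    apply: ge0_le_integral_subset => //.
    + by apply: subset_itvr; rewrite bnd_simp.
    + by move=> y _; rewrite lee_fin sqmod_ge0.
    + by move=> y _; rewrite lee_fin sqmod_ge0.
  apply: lte_mul_pinfty; rewrite ?lee_fin// lebesgue_measure_itv /=.
  by case: ifPn => _; rewrite ?ltey// -EFinB ltey.
Qed.

End CompactOperators.

(** * Compact operators on sequences with disjoint supports *)

Section AlmostEverywhere.
Context {R : realType}.
Local Notation mu := (@lebesgue_measure R).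
Implicit Types f g u : R -> R[i].

Lemma eq_ae_Rplus f g : (forall x, 0 < x -> f x = g x) -> ae_eq_Rplus f g.
Proof.
move=> fg; exists set0; split => //=.
by rewrite subset0 -subset0 => x /= h; apply: h => /in_Rplus; exact: fg.
Qed.

Lemma ae_eq_Rplus2 f1 g1 f2 g2 f g :
  (forall x, f1 x = g1 x -> f2 x = g2 x -> f x = g x) ->
  ae_eq_Rplus f1 g1 -> ae_eq_Rplus f2 g2 -> ae_eq_Rplus f g.
Proof.
move=> imp h1 h2; apply: negligibleS (negligibleU h1 h2) => x /= h.
rewrite -not_andP => -[e1 e2]; apply: h => Rx.
by apply: imp; [exact: e1|exact: e2].
Qed.

End AlmostEverywhere.

Section DisjointSequences.
Context {R : realType}.
Local Notation mu := (@lebesgue_measure R).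
Variable T : (R -> R[i]) -> R -> R[i].
Hypothesis cT : compact_operator T.

Let TL2 f : L2 f -> L2 (T f). Proof. by case: cT => -[+ _ _] _; apply. Qed.

Lemma compact_energy_bound : exists2 C : R, 0 <= C &
  forall f, L2 f -> (energy Rplus (T f) <= C%:E * energy Rplus f)%E.
Proof.
case: cT => -[_ _ [C TC]] _; exists (`|C| ^+ 2); first exact: sqr_ge0.
move=> f Lf; rewrite -L2norm_le_energy//; apply: le_trans (TC f Lf) _.
by apply: lee_wpmul2r; [exact: L2norm_ge0|rewrite lee_fin ler_norm].
Qed.

Section Sums.
Variable F : nat -> R -> R[i].
Hypothesis LF : forall n, L2 (F n).
Hypothesis F1 : forall n, (energy Rplus (F n) <= 1)%E.
Hypothesis disjF : forall m n x, m != n -> F m x = 0 \/ F n x = 0.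

Let S N m x : R[i] := \sum_(j < N) F (m + j) x.
Let U N m x : R[i] := \sum_(j < N) T (F (m + j)) x.

Let L2_0 : L2 (fun=> 0 : R[i]).
Proof.
apply/L2P; split; first exact: cmeasurable_cst.
by rewrite /energy integral0_eq// => y _; rewrite sqmod0.
Qed.

Let SS N m : S N.+1 m = fun x => 1 * F (m + N)%N x + S N m x.
Proof. by apply/funext => x; rewrite /S big_ord_recr /= mul1r addrC. Qed.

Let US N m : U N.+1 m = fun x => 1 * T (F (m + N)%N) x + U N m x.
Proof. by apply/funext => x; rewrite /U big_ord_recr /= mul1r addrC. Qed.

Let LS N m : L2 (S N m).
Proof.
elim: N => [|N ih]; last by rewrite SS; exact: L2_linear.
by rewrite (_ : S 0 m = fun=> 0)//; apply/funext => x; rewrite /S big_ord0.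
Qed.

Let LU N m : L2 (U N m).
Proof.
elim: N => [|N ih]; last by rewrite US; apply: L2_linear => //; exact: TL2.
by rewrite (_ : U 0 m = fun=> 0)//; apply/funext => x; rewrite /U big_ord0.
Qed.

Let TS N m : ae_eq_Rplus (T (S N m)) (U N m).
Proof.
have lT : forall (a : R[i]) f g, L2 f -> L2 g ->
  ae_eq_Rplus (T (fun x => a * f x + g x)) (fun x => a * T f x + T g x).
  by case: cT => -[].
elim: N => [|N ih].
  have -> : S 0 m = fun=> 0 by apply/funext => x; rewrite /S big_ord0.
  have := lT 1 _ _ L2_0 L2_0.
  rewrite (_ : (fun x => 1 * 0 + 0) = fun=> 0); last by apply/funext => x; rewrite mulr0 addr0.
  move=> h; apply: (ae_eq_Rplus2 _ h h) => x hx _.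
  rewrite /U big_ord0; apply: (addrI (T (fun=> 0) x)).
  by rewrite addr0 [in RHS]hx mul1r.
have h := lT 1 _ _ (LF (m + N)) (LS N m).
rewrite SS US; apply: ae_eq_Rplus2 h ih => x -> ->.
by [].
Qed.

Let energy_S N m : (energy Rplus (S N m) <= N%:R%:E)%E.
Proof.
have mR := @measurable_Rplus R.
elim: N => [|N ih].
  rewrite /energy integral0_eq// => x _.
  by rewrite /S big_ord0 sqmod0.
have -> : energy Rplus (S N.+1 m) = (energy Rplus (F (m + N)%N) + energy Rplus (S N m))%E.
  rewrite /energy -ge0_integralD//.
  - apply: eq_integral => x _; rewrite -EFinD SS mul1r; congr EFin.
    have [FN|FN] := eqVneq (F (m + N)%N x) 0.
      by rewrite FN add0r sqmod0 add0r.
    rewrite (_ : S N m x = 0) ?addr0 ?sqmod0 ?addr0//.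
    rewrite /S big1// => j _.
    have : m + j != m + N by rewrite eqn_add2l ltn_eqF.
    by move=> /(disjF x)[//|F0]; rewrite F0 eqxx in FN.
  - by move=> x _; rewrite lee_fin sqmod_ge0.
  - by case/L2P: (LF (m + N)) => + _; exact: measurable_EFin_sqmod.
  - by move=> x _; rewrite lee_fin sqmod_ge0.
  - by case/L2P: (LS N m) => + _; exact: measurable_EFin_sqmod.
by rewrite -natr1 addrC EFinD; apply: leeD => //; exact: F1.
Qed.

(** [S N m] is the sum of the [N] terms from rank [m] on, and [U N m] the sum of
    their images.  Disjointness gives [||S N m||^2 <= N], so [||U N m||^2 <= C N];
    as [m] grows [U N m] approaches [N g], which forces [N ||g||^2 <= 2 + 2 C]. *)
Lemma disjoint_limit_eq0 g : L2 g ->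
  energy Rplus (fun x => T (F n) x - g x) @[n --> \oo] --> 0%E ->
  energy Rplus g = 0%E.
Proof.
move=> Lg; move/cvge0P => /(_ (fun=> energy_ge0 _ _)) cvg0.
have mR := @measurable_Rplus R.
have [C C0 TC] := compact_energy_bound.
have /L2P[mg g2] := Lg.
set G := fine (energy Rplus g).
have EG : energy Rplus g = G%:E by rewrite fineK// ge0_fin_numE ?energy_ge0.
have mTF n : cmeasurable Rplus (T (F n)) by case/L2P: (TL2 (LF n)).
have key N : (0 < N)%N -> N%:R * G <= 2 + 2 * C.
  move=> N0; have eN : 0 < (4 ^+ N)^-1 :> R by rewrite invr_gt0 exprn_gt0.
  have [m _ hm] := cvg0 _ eN.
  (* Each added term at most quadruples the accumulated error; starting from
     errors 4^-N, the total after N terms is still at most 1. *)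
  have diff k : (k <= N)%N ->
      (energy Rplus (fun x => k%:R * g x - U k m x)%R <= (4 ^+ k / 4 ^+ N)%:E)%E.
    elim: k => [_|k ih kN].
      rewrite /energy integral0_eq; first by rewrite lee_fin divr_ge0// exprn_ge0.
      by move=> x _; rewrite /U big_ord0 mul0r subr0 sqmod0.
    rewrite (_ : (fun x => _) = (fun x =>
      (k%:R * g x - U k m x) - (T (F (m + k)%N) x - g x))); last first.
      by apply/funext => x; rewrite US; ring.
    apply: le_trans.
      apply: energyB_le => //.
        apply: cmeasurableD; first by apply: cmeasurableM => //; exact: cmeasurable_cst.
        by apply: cmeasurableN; case/L2P: (LU k m).
      by apply: cmeasurableD => //; exact: cmeasurableN.
    apply: (@le_trans _ _ (2%:E * (4 ^+ k / 4 ^+ N)%:E + 2%:E * (4 ^+ N)^-1%:E)%E).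
      apply: leeD; apply: lee_wpmul2l => //; first exact: ih (ltnW kN).
      by apply: hm => /=; rewrite leq_addr.
    rewrite -!EFinM -EFinD lee_fin exprS mulrA -mulrDl; apply: ler_wpM2r; first exact: ltW.
    have : 1 <= 4 ^+ k :> R by rewrite exprn_ege1// ler1n.
    by set t := 4 ^+ k => ?; lra.
  have UC : (energy Rplus (U N m) <= (C * N%:R)%:E)%E.
    rewrite -(ae_eq_energy _ _ (TS N m)); last 2 first.
    - by case/L2P: (TL2 (LS N m)).
    - by case/L2P: (LU N m).
    apply: le_trans (TC _ (LS N m)) _; rewrite EFinM.
    by apply: lee_wpmul2l; rewrite ?lee_fin.
  have : (energy Rplus (fun x => N%:R * g x)%R <= (2 + 2 * (C * N%:R))%:E)%E.
    rewrite (_ : (fun x => _) = (fun x => (N%:R * g x - U N m x) + U N m x)); last first.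
      by apply/funext => x; rewrite subrK.
    apply: le_trans.
      apply: energyD_le => //; last by case/L2P: (LU N m).
      apply: cmeasurableD; first by apply: cmeasurableM => //; exact: cmeasurable_cst.
      by apply: cmeasurableN; case/L2P: (LU N m).
    rewrite (_ : 2 + _ = 2 * 1 + 2 * (C * N%:R)); last by rewrite mulr1.
    rewrite [leRHS](_ : _ = 2%:E * 1%:E + 2%:E * (C * N%:R)%:E)%E//.
    apply: leeD; apply: lee_wpmul2l => //.
    by have := diff N (leqnn N); rewrite divff// expf_neq0.
  rewrite energyZ// EG -EFinM lee_fin.
  have -> : sqmod (N%:R : R[i]) = N%:R ^+ 2.
    rewrite (_ : N%:R = Complex (N%:R : R) 0); last by rewrite -(rmorph_nat (real_complex R)).
    by rewrite /sqmod /= expr0n addr0.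
  have N1 : 1 <= N%:R :> R by rewrite ler1n.
  move=> h; rewrite -(ler_pM2l (lt_le_trans ltr01 N1)) mulrA -expr2.
  by apply: le_trans h _; nra.
have G0 : 0 <= G by rewrite fine_ge0// energy_ge0.
rewrite EG; congr EFin; apply/eqP; rewrite eq_le G0 andbT leNgt; apply/negP => Gp.
have := archi_boundP (_ : 0 <= (2 + 2 * C) / G).
rewrite divr_ge0 ?addr_ge0 ?mulr_ge0// => /(_ isT).
set N := Num.bound _ => hN.
have N0 : (0 < N)%N.
  by rewrite -(ltr_nat R); apply: le_lt_trans hN; rewrite divr_ge0 ?addr_ge0 ?mulr_ge0.
by have := key N N0; rewrite leNgt -ltr_pdivrMr// hN.
Qed.

End Sums.

(** Otherwise a subsequence of images stays away from 0, yet by compactness a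
    further subsequence converges, and [disjoint_limit_eq0] makes its limit 0. *)
Lemma compact_disjoint_cvg0 (f : nat -> R -> R[i]) :
  (forall n, L2 (f n)) -> (forall n, (energy Rplus (f n) <= 1)%E) ->
  (forall m n x, m != n -> f m x = 0 \/ f n x = 0) ->
  energy Rplus (T (f n)) @[n --> \oo] --> 0%E.
Proof.
move=> Lf f1 disj; apply/cvge0P => [n|e e0]; first exact: energy_ge0.
apply: contrapT => nh.
have far N : exists n, (N <= n)%N /\ (e%:E < energy Rplus (T (f n)))%E.
  apply: contrapT => h; apply: nh; exists N => // n /= Nn.
  by rewrite leNgt; apply/negP => en; apply: h; exists n.
have [j hj] := choice far.
pose i := fix i n := if n is n'.+1 then j (i n').+1 else j 0.
have iinc : {homo i : m n / (m < n)%N}.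
  by apply: homo_ltn; [exact: ltn_trans|move=> n; have [] := hj (i n).+1].
have ilarge n : (e%:E < energy Rplus (T (f (i n))))%E.
  by case: n => [|n]; [have [] := hj 0%N|have [] := hj (i n).+1].
case: cT => _ /(_ (f \o i) (fun=> Lf _)); case.
  by exists 1 => n; rewrite L2norm_leP// expr1n; exact: f1.
move=> k [g [kinc Lg /L2norm_cvg0 cg]].
pose F n := f (i (k n)).
have iinj m n : m != n -> i (k m) != i (k n).
  move=> mn; have := mn; rewrite neq_ltn => /orP[] /kinc/iinc h; first by rewrite ltn_eqF.
  by rewrite gtn_eqF.
have g0 : energy Rplus g = 0%E.
  apply: (@disjoint_limit_eq0 F) => //.
  - by move=> n; exact: Lf.
  - by move=> n; exact: f1.
  - by move=> m n x mn; apply: disj; exact: iinj.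
have e2 : 0 < e / 2 by rewrite divr_gt0.
move/cvge0P : cg => /(_ (fun=> energy_ge0 _ _) _ e2)[n _ /(_ n (leqnn n)) hn].
have := ilarge (k n); rewrite ltNge => /negP; apply.
rewrite (_ : T _ = fun x => (T (F n) x - g x) + g x); last first.
  by apply/funext => x; rewrite subrK.
have [mg _] := Lg; have [mTF _] := TL2 (Lf (i (k n))).
apply: le_trans; first apply: energyD_le => //; first exact: measurable_Rplus.
  by apply: cmeasurableD => //; exact: cmeasurableN.
rewrite g0 mule0 adde0 (_ : e = 2 * (e / 2)); last by field.
by rewrite EFinM; apply: lee_wpmul2l.
Qed.

End DisjointSequences.

(** * The two implications *)

Section SufficientCondition.
Context {R : realType}.
Local Notation mu := (@lebesgue_measure R).
Variable phi : R -> R[i].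
Hypothesis mphi : cmeasurable Rplus phi.

Lemma bounded_csupp_L2 (f : R -> R[i]) : bounded_csupp f -> L2 f.
Proof.
move=> [mf [M fM] [K [cK KR f0]]]; apply/L2P; split => //.
have mK := compact_measurable cK.
have muK : (mu K < +oo)%E by exact: compact_finite_measure.
apply: (@le_lt_trans _ _ (\int[mu]_(x in K) (cst (M ^+ 2)%:E x))%E); last first.
  by rewrite integral_cst// lte_mul_pinfty// lee_fin sqr_ge0.
rewrite /energy integral_mkcond [leRHS]integral_mkcond.
apply: ge0_le_integral_subset => // x _.
- by rewrite patchE; case: ifPn => // _; rewrite lee_fin sqmod_ge0.
- by rewrite patchE; case: ifPn => // _; rewrite lee_fin sqr_ge0.
rewrite !patchE; case: ifPn => [/set_mem Rx|Rx]; last first.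
  by case: ifPn => // _; rewrite lee_fin sqr_ge0.
case: ifPn => [/set_mem Kx|/negP Kx]; last first.
  by rewrite f0 ?sqmod0// => Kx'; apply: Kx; exact: mem_set.
have cmod0 : 0 <= cmod (f x) by rewrite /cmod; case: (f x) => a b; exact: sqrtr_ge0.
by rewrite lee_fin -cmod_sq ler_sqr ?nnegrE ?fM//; exact: le_trans (fM _ Rx).
Qed.

(** [phi (max x y)] is [phi x] on ]0, x[ and [phi y] on [x, oo[. *)
Lemma Qop_split f (x : R) : X0infty phi -> L2 f -> 0 < x ->
  Qop phi f x = phi x * lower_int f x + upper_int phi f x.
Proof.
move=> [Xphi _ _] Lf x0; have [D D0 phiD] := Xinfty_dyadic_bound Xphi.
have tailoo : (energy `[x, +oo[ phi < +oo)%E.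
  by apply: le_lt_trans (energy_tail_le mphi D0 phiD x0) _; rewrite ltey.
have RE : Rplus = `]0, x[ `|` `[x, +oo[.
  by rewrite /Rplus -itv_bndbnd_setU// bnd_simp.
have subl := @itv0oo_sub_Rplus R x; have subu := itvcy_sub_Rplus x0.
pose k y := phi (Num.max x y).
have kl : {in `]0, x[%classic, k =1 fun=> phi x}.
  by move=> y /set_mem; rewrite /= in_itv /k /= => /andP[_ /ltW yx]; rewrite max_l.
have ku : {in `[x, +oo[%classic, k =1 phi}.
  by move=> y /set_mem; rewrite /= in_itv /k /= andbT => xy; rewrite max_r.
have mk : cmeasurable Rplus k.
  have [mu1 mu2] := cmeasurableS measurable_Rplus subu mphi.
  split; rewrite RE; apply/measurable_funU => //; split.
  - apply: eq_measurable_fun (measurable_cst (complex.Re (phi x))).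
    by move=> y yl; rewrite /= kl.
  - by apply: eq_measurable_fun mu1 => y yu; rewrite /= ku.
  - apply: eq_measurable_fun (measurable_cst (complex.Im (phi x))).
    by move=> y yl; rewrite /= kl.
  - by apply: eq_measurable_fun mu2 => y yu; rewrite /= ku.
have disj : `]0, x[ `&` `[x, +oo[ = set0.
  rewrite -subset0 => y /=; rewrite !in_itv /= andbT => -[/andP[_ yx]].
  by rewrite leNgt yx.
have koo : (energy Rplus k < +oo)%E.
  rewrite /energy RE ge0_integral_setU//; last 3 first.
  - by rewrite -RE; exact: measurable_EFin_sqmod.
  - by move=> y _; rewrite lee_fin sqmod_ge0.
  - exact/disj_set2P.
  rewrite -/(energy _ k) -/(energy _ k) (eq_energy ku) (eq_energy kl).
  apply: lte_add_pinfty => //; rewrite /energy integral_cst//=.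
  by rewrite lebesgue_measure_itv /= lte_fin x0 -EFinB -EFinM ltey.
have ik : cintegrable Rplus (fun y => k y * f y).
  by apply: cintegrable_mul => //; exact: measurable_Rplus.
rewrite /Qop [in LHS]RE cintegral_setU//; last by rewrite -RE.
congr (_ + _); last by apply: eq_cintegral => y yu; rewrite -/(k y) ku.
rewrite -cintegralZ//; first by apply: eq_cintegral => y yl; rewrite -/(k y) kl.
rewrite (_ : f = fun y => 1 * f y); last by apply/funext => y; rewrite mul1r.
apply: cintegrable_mul => //.
by rewrite energy_cst1_itv// ltey.
Qed.

Lemma X0infty_Qplus_compact : X0infty phi -> compact_on_L2 (Qplus phi).
Proof.
move=> X0; exists (fun f x => phi x * lower_int f x); split.
  exact/energy_compact_compact/energy_compact_lower.
by move=> f _; exact: eq_ae_Rplus.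
Qed.

Lemma X0infty_Qop_compact : X0infty phi -> compact_on_L2 (Qop phi).
Proof.
move=> X0; exists (fun f x => phi x * lower_int f x + upper_int phi f x); split.
  apply/energy_compact_compact/energy_compactD; first exact: energy_compact_lower.
  exact: energy_compact_upper.
move=> f /bounded_csupp_L2 Lf; apply: eq_ae_Rplus => x x0.
by rewrite Qop_split.
Qed.

End SufficientCondition.

Section Necessity.
Context {R : realType}.
Local Notation mu := (@lebesgue_measure R).

(** The height [1 / sqrt a] gives all bumps the same energy 1/2, and those with
    [a] a power of 2 have pairwise disjoint supports. *)
Definition bump (a : R) (x : R) : R[i] :=
  Complex (((fun=> (Num.sqrt a)^-1) \_ `]a / 2, a]) x) 0.

Lemma bump_out (a x : R) : ~ (a / 2 < x <= a) -> bump a x = 0.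
Proof.
by move=> h; rewrite /bump patchE memNset//= in_itv.
Qed.

Lemma bump_itv_plus (a : R) : 0 < a -> `]a / 2, a] `<=` Rplus.
Proof.
move=> a0 x; rewrite /= in_itv /= => /andP[ax _]; apply/in_Rplus.
by apply: le_lt_trans ax; rewrite divr_ge0// ltW.
Qed.

Lemma cmeasurable_bump (a : R) : cmeasurable Rplus (bump a).
Proof.
split; last exact: measurable_cst.
apply/(measurable_restrict _ (measurable_itv _) measurable_Rplus).
exact: measurable_cst.
Qed.

Lemma bump_bounded_csupp (a : R) : 0 < a -> bounded_csupp (bump a).
Proof.
move=> a0; split; first exact: cmeasurable_bump.
- exists (Num.sqrt a)^-1 => x _.
  rewrite /cmod /bump /= expr0n addr0 sqrtr_sqr patchE.
  by case: ifPn => _; rewrite ?normr0 ?invr_ge0// ger0_norm// invr_ge0.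
- exists `[a / 2, a]%classic; split; first exact: segment_compact.
    move=> x; rewrite /= in_itv /= => /andP[ax _]; apply/in_Rplus.
    by apply: lt_le_trans ax; rewrite divr_gt0.
  move=> x _ h; apply: bump_out => /andP[h1 h2]; apply: h.
  by rewrite /= in_itv /= h2 ltW.
Qed.

Lemma measure_bump_itv (a : R) : 0 < a -> mu `]a / 2, a] = (a / 2)%:E.
Proof.
move=> a0; rewrite lebesgue_measure_itv /= lte_fin ltr_pdivrMr// ltr_pMr// ltr1n.
by rewrite -EFinB; congr EFin; field.
Qed.

Lemma energy_bump (a : R) : 0 < a -> (energy Rplus (bump a) <= 1)%E.
Proof.
move=> a0.
apply: (@le_trans _ _ (\int[mu]_(x in `](a / 2)%R, a]) (cst (a^-1)%:E x))%E); last first.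
  rewrite integral_cst// [X in (_ * X)%E]measure_bump_itv// -EFinM lee_fin.
  by rewrite mulrA mulVf ?gt_eqF// mul1r invf_le1// ler1n.
rewrite /energy integral_mkcond [leRHS]integral_mkcond.
apply: ge0_le_integral_subset => // x _.
- by rewrite patchE; case: ifPn => // _; rewrite lee_fin sqmod_ge0.
- by rewrite patchE; case: ifPn => // _; rewrite lee_fin invr_ge0 ltW.
rewrite !patchE; case: ifPn => [_|_]; last first.
  by case: ifPn => // _; rewrite lee_fin invr_ge0 ltW.
rewrite /bump /sqmod /= patchE; case: ifPn => _; rewrite ?expr0n ?addr0//.
by rewrite exprVn sqr_sqrtr// ltW.
Qed.

Lemma cintegral_bump (D : set R) (a : R) (c : R[i]) : 0 < a -> measurable D ->
  `]a / 2, a] `<=` D ->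
  cintegral D (fun y => c * bump a y) = c * Complex (Num.sqrt a / 2) 0.
Proof.
move=> a0 mD aD; rewrite cintegralZ//; last first.
  split.
    rewrite -restrict_EFin; apply/integrable_restrict => //.
    rewrite setIidr//; apply/integrableP; split; first exact/measurable_EFinP.
    apply: le_lt_trans.
      by apply: (@integral_le_cst R _ (fun=> `|(Num.sqrt a)^-1|) `|(Num.sqrt a)^-1|).
    by rewrite [X in (_ * X)%E]measure_bump_itv// -EFinM ltey.
  exact: integrable0.
congr (_ * _); apply: complex_ext => /=; last by rewrite /Rintegral integral0.
rewrite -Rintegral_mkcondr setIidr// Rintegral_cst// [X in fine X]measure_bump_itv//=.
rewrite -{2}(sqr_sqrtr (ltW a0)).
by field; rewrite gt_eqF// sqrtr_gt0.
Qed.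

Lemma Qplus_bump (phi : R -> R[i]) (a x : R) : 0 < a -> a < x ->
  Qplus phi (bump a) x = phi x * Complex (Num.sqrt a / 2) 0.
Proof.
move=> a0 ax; rewrite /Qplus; congr (_ * _).
rewrite (_ : bump a = fun y => 1 * bump a y); last by apply/funext => y; rewrite mul1r.
rewrite cintegral_bump ?mul1r// => y; rewrite /= !in_itv /= => /andP[ay ya].
by rewrite (le_lt_trans ya ax) andbT (le_lt_trans _ ay)// divr_ge0// ltW.
Qed.

Lemma Qop_bump (phi : R -> R[i]) (a x : R) : 0 < a -> a < x ->
  Qop phi (bump a) x = phi x * Complex (Num.sqrt a / 2) 0.
Proof.
move=> a0 ax; rewrite -(cintegral_bump _ _ measurable_Rplus (bump_itv_plus a0))//.
apply: eq_cintegral => y _; have [ya|ay] := leP y a.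
  by rewrite max_l// ltW// (le_lt_trans ya).
by rewrite bump_out ?mulr0// => /andP[_]; rewrite leNgt ay.
Qed.

(** Only the values of [Q] on bumps enter, to the right of the bump; this is where
    [Qop] and [Qplus] coincide. *)
Lemma compact_on_L2_X0infty (phi : R -> R[i]) (Q : (R -> R[i]) -> R -> R[i]) :
  cmeasurable Rplus phi ->
  (forall a x : R, 0 < a -> a < x -> Q (bump a) x = phi x * Complex (Num.sqrt a / 2) 0) ->
  compact_on_L2 Q -> X0infty phi.
Proof.
move=> mphi Qbump [T [cT TQ]].
have Lb (a : R) : 0 < a -> L2 (bump a).
  by move=> a0; apply/bounded_csupp_L2/bump_bounded_csupp.
have mR := @measurable_Rplus R.
have low (n : int) : (dyadic phi n <= 4%:E * energy Rplus (T (bump (2 ^ n))))%E.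
  have a0 := @exp2z_gt0 R n; set a := 2 ^ n in a0 *.
  have sub : `]a, 2 ^ (n + 1)] `<=` Rplus.
    by move=> x; rewrite /= in_itv /= => /andP[ax _]; apply/in_Rplus; exact: lt_trans ax.
  have mphi' := cmeasurableS mR sub mphi.
  have mTb : cmeasurable Rplus (T (bump a)) by have [[+ _ _] _] := cT; move=> /(_ _ (Lb _ a0))[].
  apply: (@le_trans _ _ (4%:E * energy `]a, 2 ^ (n + 1)] (T (bump a)))%E); last first.
    apply: lee_wpmul2l => //.
    by apply: ge0_le_integral_subset => // x _; rewrite lee_fin sqmod_ge0.
  have -> : energy `]a, (2 ^ (n + 1))%R] (T (bump a)) =
      energy `]a, (2 ^ (n + 1))%R] (fun x => Complex (Num.sqrt a / 2) 0 * phi x)%R.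
    apply: ge0_ae_eq_integral => //.
    - by apply: measurable_EFin_sqmod; exact: cmeasurableS mR sub mTb.
    - apply: measurable_EFin_sqmod; apply: cmeasurableM => //; exact: cmeasurable_cst.
    - by move=> x _; rewrite lee_fin sqmod_ge0.
    - by move=> x _; rewrite lee_fin sqmod_ge0.
    - case: (TQ _ (bump_bounded_csupp a0)) => N [mN N0 subN].
      exists N; split => //; apply: subset_trans subN => x /= h.
      move=> eqx; apply: h => Dx; rewrite eqx; last exact: sub.
      by move: Dx; rewrite in_itv /= => /andP[ax _]; rewrite Qbump// mulrC.
  rewrite energyZ// dyadicE -/a muleA -EFinM.
  rewrite (_ : 4 * _ = a); last first.
    by rewrite /sqmod /= expr0n addr0 exprMn sqr_sqrtr ?ltW//; field.
  rewrite /energy integral_itv_obnd_cbnd//; exact: measurable_EFin_sqmod.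
have [C C0 TC] := compact_energy_bound cT.
have cvg0 (z : nat -> int) : injective z ->
    (fun n => dyadic phi (z n)) @ \oo --> 0%E.
  move=> zinj.
  have h := @compact_disjoint_cvg0 R T cT (fun n => bump (2 ^ (z n))).
  have d0 n : (0 <= dyadic phi (z n))%E.
    rewrite dyadicE; apply: mule_ge0; first by rewrite lee_fin ltW// exp2z_gt0.
    by apply: integral_ge0 => x _; rewrite lee_fin sqmod_ge0.
  apply/cvge0P => // e e0; have e4 : 0 < e / 4 by rewrite divr_gt0.
  have : energy Rplus (T (bump (2 ^ z n))) @[n --> \oo] --> 0%E.
    apply: h => [n|n|m n x mn].
    - by apply: Lb; exact: exp2z_gt0.
    - by apply: energy_bump; exact: exp2z_gt0.
    have disj (i j : int) : i < j -> bump (2 ^ i) x = 0 \/ bump (2 ^ j) x = 0.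
      move=> ij; have [xi|xi] := leP x (2 ^ i).
        right; apply: bump_out => /andP[xj _]; move: xj; rewrite ltNge => /negP; apply.
        apply: le_trans xi _; rewrite ler_pdivlMr// mulrC -exp2zS.
        by rewrite ler_eXz2l ?ltr1n// lezD1.
      by left; apply: bump_out => /andP[_]; rewrite leNgt xi.
    have : z m != z n by rewrite (inj_eq zinj).
    by case: ltgtP => // [/disj//|/disj[]]; [right|left].
  move=> /(cvge0P (fun=> energy_ge0 _ _)).1 /(_ _ e4); apply: filterS => n hn.
  apply: le_trans (low _) _; rewrite (_ : e = 4 * (e / 4)); last by field.
  by rewrite EFinM; apply: lee_wpmul2l.
split.
- split => //; apply: (@le_lt_trans _ _ (4 * C)%:E); last by rewrite ltey.
  apply: ge_ereal_sup => _ [n _ <-]; apply: le_trans (low n) _.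
  rewrite EFinM; apply: lee_wpmul2l => //.
  apply: le_trans (TC _ (Lb _ (exp2z_gt0 _))) _.
  rewrite -[leRHS]mule1; apply: lee_wpmul2l; rewrite ?lee_fin//.
  exact/energy_bump/exp2z_gt0.
- by apply: cvg0 => m n [].
- by apply: cvg0 => m n /oppr_inj [].
Qed.

End Necessity.

Theorem theorem3p2 (R : realType) (phi : R -> R[i]) (hphi : L1loc phi) :
  (compact_on_L2 (Qop phi) <-> compact_on_L2 (Qplus phi)) /\
  (compact_on_L2 (Qplus phi) <-> X0infty phi).
Proof.
have [mphi _] := hphi.
have Qop_X0 : compact_on_L2 (Qop phi) -> X0infty phi.
  by apply: compact_on_L2_X0infty => // a x; exact: Qop_bump.
have Qplus_X0 : compact_on_L2 (Qplus phi) -> X0infty phi.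
  by apply: compact_on_L2_X0infty => // a x; exact: Qplus_bump.
split; split.
- by move=> /Qop_X0; exact: X0infty_Qplus_compact.
- by move=> /Qplus_X0; exact: X0infty_Qop_compact.
- exact: Qplus_X0.
- exact: X0infty_Qplus_compact.
Qed.
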